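(* There exist two non-isomorphic simplicial complexes, each with geometric realization homeomorphic to the torus $S^1\times S^1$, whose facet-ridge graphs are isomorphic. Likewise, there exist two non-isomorphic simplicial complexes, each with geometric realization homeomorphic to the real projective plane $\mathbb{RP}^2$, whose facet-ridge graphs are isomorphic.
   Context: Simplicial complexes are finite. The facets of a simplicial complex are its inclusion-maximal faces; ridges are the faces consisting of all but one vertex of a facet. The facet-ridge graph has as vertices the facets and as edges the pairs of distinct facets that both contain a common ridge of both facets. Isomorphism of simplicial complexes means a bijection of vertices inducing a bijection of faces. *)

(* Defs.v *)
From HB Require Import structures.
From mathcomp Require Import all_boot all_order all_algebra generic_quotient.
From mathcomp Require Import all_classical all_reals all_analysis.

Set Implicit Arguments.
Unset Strict Implicit.
Unset Printing Implicit Defensive.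

Import Order.TTheory GRing.Theory Num.Theory.
Import numFieldNormedType.Exports.

Local Open Scope classical_set_scope.
Local Open Scope ring_scope.
Local Open Scope quotient_scope.

(* The empty set is a face, and every element of [V] is a vertex (there are
   no ghost vertices), so that maps [V -> W] are maps of vertices. *)
Record simplicial_complex (V : finType) := SimplicialComplex {
  faces : {set {set V}};
  face_set0 : finset.set0 \in faces;
  face_set1 : forall v : V, [set v]%SET \in faces;
  face_subset : forall A B : {set V},
    B \in faces -> A \subset B -> A \in faces }.

Definition complex_iso (V W : finType)
    (K : simplicial_complex V) (L : simplicial_complex W) : Prop :=
  exists2 f : V -> W, bijective f &
    [set f @: A | A : {set V} in faces K]%SET = faces L.

Section FacetRidgeGraph.
Variables (V : finType) (K : simplicial_complex V).

Definition is_facet (F : {set V}) : bool := maxset (fun A => A \in faces K) F.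

Definition is_ridge_of (r F : {set V}) : bool :=
  is_facet F && [exists v in F, r == (F :\ v)%SET].

Definition facet : finType := {F : {set V} | is_facet F}.

Definition facet_ridge_graph : rel facet :=
  fun F G => (F != G) &&
    [exists r : {set V}, is_ridge_of r (val F) && is_ridge_of r (val G)].

End FacetRidgeGraph.

Definition graph_iso (T U : finType) (e : rel T) (e' : rel U) : Prop :=
  exists2 f : T -> U, bijective f & forall x y, e' (f x) (f y) = e x y.

Definition homeomorphic (X Y : topologicalType) : Prop :=
  exists (f : X -> Y) (g : Y -> X),
    [/\ cancel f g, cancel g f, continuous f & continuous g].

Section Spaces.
Variable R : realType.

(* Barycentric coordinates: points of R^V, with its product topology, that are
   convex combinations of the unit vectors and are supported on a face. *)
Definition realization_set (V : finType) (K : simplicial_complex V) :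
    set {ptws V -> R} :=
  [set x | [/\ forall v, 0 <= x v, \sum_v x v = 1
             & [set v | x v != 0]%SET \in faces K]].

Definition realization (V : finType) (K : simplicial_complex V) :
  topologicalType := realization_set K.

Definition sphere (n : nat) : set 'rV[R]_n.+1 :=
  [set x | \sum_i x ord0 i ^+ 2 = 1].

Arguments sphere : clear implicits.

Definition torus : topologicalType := (sphere 1 * sphere 1)%type.

Definition antipodal_rel (n : nat) : rel (sphere n) :=
  fun x y => (val x == val y) || (val x == - val y).

Lemma antipodal_rel_refl n : reflexive (@antipodal_rel n).
Proof. by move=> x; rewrite /antipodal_rel eqxx. Qed.

Lemma antipodal_rel_sym n : symmetric (@antipodal_rel n).
Proof.
by move=> x y; rewrite /antipodal_rel eq_sym -eqr_oppLR [- _ == _]eq_sym.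
Qed.

Lemma antipodal_rel_trans n : transitive (@antipodal_rel n).
Proof.
move=> y x z; rewrite /antipodal_rel => /orP[] /eqP -> // /orP[] /eqP ->.
  by rewrite eqxx orbT.
by rewrite opprK eqxx.
Qed.

Canonical antipodal_equiv n := EquivRel (@antipodal_rel n)
  (@antipodal_rel_refl n) (@antipodal_rel_sym n) (@antipodal_rel_trans n).

Definition projective_space (n : nat) : topologicalType :=
  quotient_topology {eq_quot (antipodal_equiv n)}.

End Spaces.

Arguments realization_set R [V] K.
Arguments realization R [V] K.
Arguments sphere R n : clear implicits.
Arguments facet_ridge_graph [V] K.

(* Main.v *)
Require Import Defs.
From mathcomp Require Import all_boot all_order all_algebra generic_quotient.
From mathcomp Require Import all_classical all_reals all_analysis.
From mathcomp Require Import lra ring zify.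

Set Implicit Arguments.
Unset Strict Implicit.
Unset Printing Implicit Defensive.

Import Order.TTheory GRing.Theory Num.Theory.
Import numFieldNormedType.Exports.

Local Open Scope classical_set_scope.
Local Open Scope ring_scope.

(** Both surfaces are treated in the same way.  Take a triangulation with nine
    vertices for which a homeomorphism with the surface can be written down,
    and change it by edge flips, each replacing the two triangles abc, acd on
    an edge ac by abd, bcd on the other diagonal of the quadrilateral.  Two
    different sequences of flips lead to triangulations K and L.

    A flip does not change the homeomorphism type: sliding a point of the
    quadrilateral along the relation a + c = b + d between its corners, as far
    as its coordinates stay nonnegative, is a continuous map whose inverse has
    the same form with the diagonals exchanged ([shearP],
    [flip_path_homeomorphic]).

    The starting triangulation of the torus is the three by three grid with
    all squares cut along parallel diagonals.  The circle is identified with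
    the boundary of a triangle by the fan of the three rays (1,0), (0,1),
    (-1,-1) in the plane, and the product of two triangle boundaries with the
    grid by a min-max formula for the coordinates of a point in a cut square
    ([torus_grid_homeomorphic]).  The starting triangulation of the projective
    plane is the octahedron, every face cut into four by the midpoints of its
    edges, modulo the antipodal map; its barycentric coordinates are even
    piecewise linear functions on space ([projective_grid_homeomorphic]).
    As the surface is compact and the polyhedron Hausdorff, it suffices that these
    maps are continuous bijections ([compact_hausdorff_homeomorphic]).

    The rest is finite.  The triangles of K and of L are listed in such an
    order that the i-th and j-th triangles of K share an edge exactly when
    those of L do, so the facet-ridge graphs are isomorphic
    ([same_adjacency_graph_iso]).  But only one of K and L has a vertex joined
    by edges to all the others, so K and L are not isomorphic
    ([complex_iso_universal]). *)

(** * Compact and Hausdorff spaces *)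

Lemma homeomorphic_refl (X : topologicalType) : homeomorphic X X.
Proof. by exists id, id; split=> // x; exact: cvg_id. Qed.

Lemma homeomorphic_sym (X Y : topologicalType) :
  homeomorphic X Y -> homeomorphic Y X.
Proof. by move=> [f [g [fK gK fc gc]]]; exists g, f. Qed.

Lemma homeomorphic_trans (Y X Z : topologicalType) :
  homeomorphic X Y -> homeomorphic Y Z -> homeomorphic X Z.
Proof.
move=> [f [f' [fK f'K fc f'c]]] [g [g' [gK g'K gc g'c]]].
exists (g \o f), (f' \o g'); split; [exact: can_comp|exact: can_comp| |].
- by move=> x; apply: continuous_comp; [exact: fc|exact: gc].
- by move=> x; apply: continuous_comp; [exact: g'c|exact: f'c].
Qed.

Lemma compact_hausdorff_homeomorphic (X Y : topologicalType) (f : X -> Y) :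
  compact [set: X] -> hausdorff_space Y -> continuous f ->
  injective f -> (forall y, exists x, f x = y) -> homeomorphic X Y.
Proof.
move=> cX hY cf fI fS.
have [g gK] := choice fS.
have fK : cancel f g by move=> x; apply: fI; rewrite gK.
exists f, g; split => //.
apply/continuous_closedP => A clA.
have -> : g @^-1` A = f @` A.
  apply/seteqP; split => [y /= Ay|_ [x Ax <-]] /=; last by rewrite fK.
  by exists (g y).
apply: compact_closed => //; apply: continuous_compact.
  exact: continuous_subspaceT.
exact: subclosed_compact cX _.
Qed.

(** A filter on the subtype is pushed to the ambient space, where it clusters
    at a point of the compact set; this point lies in the subtype. *)
Lemma compact_subtype (X : topologicalType) (A : set X) :
  compact A -> compact [set: A].
Proof.
move=> cA F PF _.
have FA : (set_val @ F) A.
  by apply: (@filterS _ F _ setT) => [x _|]; [exact: set_valP|exact: filterT].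
have [p [Ap clp]] := cA _ (fmap_proper_filter set_val PF) FA.
exists (SigSub (mem_set Ap)); split => // S T FS [_ [[W oW <-] Wp] WT].
have FS' : (set_val @ F) (set_val @` S).
  by apply: (@filterS _ F _ S) => // s Ss; exists s.
have [|_ [[s Ss <-] Ws]] := clp _ W FS'; first exact: open_nbhs_nbhs.
by exists s; split => //; exact: WT.
Qed.

Lemma hausdorff_subtype (X : topologicalType) (A : set X) :
  hausdorff_space X -> hausdorff_space A.
Proof.
move=> hX x y clxy; apply: val_inj; apply: hX => S T Sx Ty.
have cv : continuous (set_val : A -> X) by exact: initial_continuous.
have [z [Sz Tz]] := clxy _ _ (cv x _ Sx) (cv y _ Ty).
by exists (set_val z).
Qed.

Lemma continuous_subtype (X Y : topologicalType) (A : set Y) (f : X -> A) :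
  continuous (set_val \o f) -> continuous f.
Proof. exact: (@continuous_comp_initial _ _ _ (@set_val _ A)). Qed.

Lemma continuous_sum (R : realType) (X : topologicalType) (I : Type)
    (r : seq I) (F : I -> X -> R) :
  (forall i, continuous (F i)) -> continuous (fun x => \sum_(i <- r) F i x).
Proof.
move=> cF; elim: r => [|i r IHr] x.
  by under eq_fun do rewrite big_nil; exact: cvg_cst.
under eq_fun do rewrite big_cons.
by apply: cvgD; [exact: cF|exact: IHr].
Qed.

Lemma compact_sphere (R : realType) n : compact [set: sphere R n].
Proof.
apply: compact_subtype; apply: bounded_closed_compact.
  exists 1; split=> // M M1 x /= sx.
  rewrite [leLHS]/Num.norm /= mx_normrE; apply/bigmax_leP; split=> [|[i j] _ /=].
    lra.
  have : `|x i j| ^+ 2 <= 1.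
    rewrite -sx (ord1 i) real_normK ?num_real// (bigD1 j)//= lerDl.
    by apply: sumr_ge0 => k _; exact: sqr_ge0.
  by rewrite expr_le1 //= => /le_trans; apply; exact: ltW.
have -> : sphere R n =
    (fun x : 'rV[R]_n.+1 => \sum_i x ord0 i ^+ 2) @^-1` [set 1].
  by [].
apply: closed_comp; last exact: closed_eq.
move=> x _; move: x; apply: continuous_sum => i x.
apply: (@continuous_comp _ _ _ (fun x : 'rV[R]_n.+1 => x ord0 i)
  (fun y => y ^+ 2)).
  exact: coord_continuous.
exact: exprn_continuous.
Qed.

Lemma compact_torus (R : realType) : compact [set: torus R].
Proof. by rewrite -setXTT; apply: compact_setX; exact: compact_sphere. Qed.

Lemma compact_projective_space (R : realType) n :
  compact [set: projective_space R n].
Proof.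
pose p := (\pi_(projective_space R n)%qT : sphere R n -> projective_space R n).
have -> : [set: projective_space R n] = p @` setT.
  by apply/seteqP; split=> // y _; exists (repr y) => //; exact: reprK.
apply: continuous_compact; last exact: compact_sphere.
by apply: continuous_subspaceT; exact: pi_continuous.
Qed.

(** * Complexes and polyhedra spanned by lists of faces *)
Definition vset n (t : seq nat) : {set 'I_n} := [set i | val i \in t]%SET.

Definition spanning n (s : seq (seq nat)) :=
  all (fun i => has (fun t => i \in t) s) (iota 0 n).

Section SpanComplex.
Variables (n : nat) (s : seq (seq nat)) (sP : spanning n.+1 s).

Definition span_faces : {set {set 'I_n.+1}} :=
  [set A : {set 'I_n.+1} | has (fun t => A \subset vset n.+1 t) s]%SET.

Lemma span_set1 (v : 'I_n.+1) : [set v]%SET \in span_faces.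
Proof.
have /(allP sP)/hasP[t ts vt] : val v \in iota 0 n.+1 by rewrite mem_iota /=.
by rewrite inE; apply/hasP; exists t => //; rewrite finset.sub1set inE.
Qed.

Lemma span_subset (A B : {set 'I_n.+1}) :
  B \in span_faces -> A \subset B -> A \in span_faces.
Proof.
rewrite !inE => /hasP[t ts Bt] AB; apply/hasP; exists t => //.
exact: fintype.subset_trans Bt.
Qed.

Lemma span_set0 : finset.set0 \in span_faces.
Proof. exact: span_subset (span_set1 ord0) (finset.sub0set _). Qed.

Definition span_complex := SimplicialComplex span_set0 span_set1 span_subset.

End SpanComplex.

(** The realization, without the requirement that every index below [n] be a
    vertex: intermediate steps need no such proof, and equal point sets give
    equal spaces. *)
Definition polyhedron (R : realType) n (s : seq (seq nat)) :
    set {ptws 'I_n -> R} :=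
  [set x | [/\ forall v, 0 <= x v, \sum_v x v = 1
             & exists2 t, t \in s & forall v, x v != 0 -> val v \in t]].
Arguments polyhedron : clear implicits.

Lemma realization_span R n s (sP : spanning n.+1 s) :
  realization_set R (span_complex sP) = polyhedron R n.+1 s.
Proof.
apply/seteqP; split=> x [x0 x1 xs]; split=> //.
  move: xs; rewrite inE => /hasP[t ts /fintype.subsetP xt]; exists t => // v xv.
  by have := xt v; rewrite !inE => /(_ xv).
case: xs => t ts xt; rewrite inE; apply/hasP; exists t => //.
by apply/fintype.subsetP => v; rewrite !inE => /xt.
Qed.

Lemma polyhedron_hausdorff R n s : hausdorff_space (polyhedron R n s).
Proof.
by apply: hausdorff_subtype; apply: hausdorff_product => _; exact: Rhausdorff.
Qed.

Lemma continuous_polyhedron R n s (X : topologicalType)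
    (f : X -> polyhedron R n s) :
  (forall v, continuous (fun p => val (f p) v)) -> continuous f.
Proof.
move=> cf; apply: continuous_subtype => p.
apply/cvg_sup => v.
by apply: (@continuous_comp_initial _ X R (fun y : 'I_n -> R => y v)); exact: cf.
Qed.

Lemma continuous_coord R n s v :
  continuous (fun x : polyhedron R n s => val x v).
Proof.
move=> x; apply: (@continuous_comp _ _ _ set_val (fun y : {ptws 'I_n -> R} => y v)).
  exact: initial_continuous.
exact: (@proj_continuous _ (fun=> R) v).
Qed.

(** The pointwise operations are restated for globally continuous functions so
    that min-max formulas can be treated by composing terms. *)
Section ContinuousReal.
Variables (R : realType) (X : topologicalType).
Implicit Types f g : X -> R.

Lemma continuous_addr f g :
  continuous f -> continuous g -> continuous (fun x => f x + g x).
Proof. by move=> cf cg x; apply: cvgD; [exact: cf|exact: cg]. Qed.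

Lemma continuous_subr f g :
  continuous f -> continuous g -> continuous (fun x => f x - g x).
Proof. by move=> cf cg x; apply: cvgB; [exact: cf|exact: cg]. Qed.

Lemma continuous_oppr f : continuous f -> continuous (fun x => - f x).
Proof. by move=> cf x; apply: cvgN; exact: cf. Qed.

Lemma continuous_mulrn f n : continuous f -> continuous (fun x => f x *+ n).
Proof. by move=> cf x; apply: cvgMn; exact: cf. Qed.

Lemma continuous_divr f g : (forall x, g x != 0) ->
  continuous f -> continuous g -> continuous (fun x => f x / g x).
Proof.
by move=> g0 cf cg x; apply: cvgM; [exact: cf|apply: cvgV; [exact: g0|exact: cg]].
Qed.

Lemma continuous_normr f : continuous f -> continuous (fun x => `|f x|).
Proof. by move=> cf x; apply: cvg_norm; exact: cf. Qed.

Lemma continuous_minr f g :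
  continuous f -> continuous g -> continuous (fun x => Num.min (f x) (g x)).
Proof. by move=> cf cg x; apply: continuous_min; [exact: cf|exact: cg]. Qed.

Lemma continuous_maxr f g :
  continuous f -> continuous g -> continuous (fun x => Num.max (f x) (g x)).
Proof. by move=> cf cg x; apply: continuous_max; [exact: cf|exact: cg]. Qed.

End ContinuousReal.

(** * Edge flips *)
Definition included_in (s : seq (seq nat)) (t : seq nat) :=
  has (fun t' => all (mem t') t) s.

Section Flip.
Variables (R : realType) (n : nat).

(** The translation along b + d - a - c by the largest amount that keeps the
    coordinates at a and c nonnegative; it maps a point of the triangles on
    the edge ac to the point at the same place of the triangles on bd. *)
Definition shear (a c b d : 'I_n) (x : {ptws 'I_n -> R}) : {ptws 'I_n -> R} :=
  fun v => let m := Num.min (x a) (x c) in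
    x v + m *+ (v == b) + m *+ (v == d) - m *+ (v == a) - m *+ (v == c).

(** The half of the flip condition used in one direction: faces on the edge ac
    lie in the quadrilateral and no face contains the edge bd, while [s'] has
    the triangles on bd and all faces of [s] that avoid the edge ac. *)
Definition unlinks (a c b d : nat) (s s' : seq (seq nat)) :=
  [&& included_in s' [:: a; b; d], included_in s' [:: c; b; d]
    & all (fun t => ~~ ((b \in t) && (d \in t)) &&
          (if (a \in t) && (c \in t) then all (mem [:: a; c; b; d]) t
           else included_in s' t)) s].

Lemma sum_delta (m : R) (a : 'I_n) : \sum_v m *+ (v == a) = m.
Proof.
by rewrite (bigD1 a)//= eqxx big1 ?addr0// => v /negbTE->; rewrite mulr0n.
Qed.

Lemma included_inP (s : seq (seq nat)) t : included_in s t ->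
  exists2 t', t' \in s & {subset t <= t'}.
Proof. by move=> /hasP[t' t's /allP tt']; exists t'. Qed.

(** A point of the first complex has a vanishing coordinate at b or at d.  After
    the shear by m = min (x a) (x c) one of the coordinates at a and c vanishes,
    which gives the new supporting triangle, and min at b and d has become m,
    so the opposite shear undoes the first one. *)
Lemma shearP (a c b d : 'I_n) s s' (x : {ptws 'I_n -> R}) :
  uniq [:: a; c; b; d] -> unlinks a c b d s s' -> polyhedron R n s x ->
  polyhedron R n s' (shear a c b d x) /\
  shear b d a c (shear a c b d x) = x.
Proof.
move=> acbd /and3P[/included_inP[abd abds abdP] /included_inP[cbd cbds cbdP]].
move=> /allP st [x0 x1 [t ts xt]].
have {st} /andP[bdt tP] := st _ ts.
have xN0 v : val v \notin t -> x v = 0.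
  by apply: contraNeq => /xt.
have mbd : Num.min (x b) (x d) = 0.
  move: bdt; rewrite negb_and => /orP[] /xN0 ->.
    by rewrite min_l.
  by rewrite min_r.
have := acbd; rewrite /= !inE !negb_or -!andbA => /and5P[ac ab ad cb /and3P[cd bd _]].
have sumE : \sum_v shear a c b d x v = 1.
  by rewrite /shear !sumrB !big_split/= !sum_delta x1; lra.
case: ifP tP => [/andP[at_ ct] /allP t4 | act /included_inP[t' t's' tt']]; last first.
  have mac : Num.min (x a) (x c) = 0.
    move/negbT: act; rewrite negb_and => /orP[] /xN0 ->.
      by rewrite min_l.
    by rewrite min_r.
  have -> : shear a c b d x = x.
    by apply/funext => v; rewrite /shear mac !mul0rn; lra.
  split.
    by split => //; exists t' => // v /xt/tt'.
  by apply/funext => v; rewrite /shear mbd !mul0rn; lra.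
have x4 v : v \notin [:: a; c; b; d] -> x v = 0.
  by move=> v4; apply: xN0; apply: contra v4 => /t4; rewrite !inE.
set m := Num.min (x a) (x c).
have m0 : 0 <= m by rewrite le_min !x0.
have ma : m <= x a by rewrite ge_min lexx.
have mc : m <= x c by rewrite ge_min lexx orbT.
(* The shear at the four corners of the quadrilateral, and away from it. *)
have sE v : shear a c b d x v =
    x v + m *+ (v == b) + m *+ (v == d) - m *+ (v == a) - m *+ (v == c) by [].
have sa : shear a c b d x a = x a - m.
  by rewrite sE eqxx (negbTE ab) (negbTE ad) (negbTE ac) /=; lra.
have sc : shear a c b d x c = x c - m.
  by rewrite sE eqxx (negbTE cb) (negbTE cd) eq_sym (negbTE ac) /=; lra.
have sb : shear a c b d x b = x b + m.
  rewrite sE eqxx (negbTE bd) ![b == _]eq_sym (negbTE ab) (negbTE cb) /=; lra.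
have sd : shear a c b d x d = x d + m.
  rewrite sE eqxx ![d == _]eq_sym (negbTE bd) (negbTE ad) (negbTE cd) /=; lra.
have s4 v : v \notin [:: a; c; b; d] -> shear a c b d x v = 0.
  move=> v4; rewrite sE x4//; move: v4; rewrite !inE !negb_or.
  by move=> /and4P[/negbTE-> /negbTE-> /negbTE-> /negbTE->] /=; lra.
split; last first.
  apply/funext => v; rewrite {1}/shear sb sd -addr_minl mbd add0r sE.
  lra.
split=> //.
  move=> v; have [|/s4 -> //] := boolP (v \in [:: a; c; b; d]).
  have xb := x0 b; have xd := x0 d.
  by rewrite !inE => /or4P[] /eqP->; rewrite ?(sa, sb, sc, sd); lra.
have [xac|xca] := leP (x a) (x c).
  exists cbd => // v sv; apply: cbdP; rewrite !inE; move: sv.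
  apply: contraNT; rewrite !negb_or => /and3P[vc vb vd].
  have [->|va] := eqVneq v a; first by rewrite sa /m min_l// subrr.
  by rewrite s4// !inE !negb_or va vc vb vd.
exists abd => // v sv; apply: abdP; rewrite !inE; move: sv.
apply: contraNT; rewrite !negb_or => /and3P[va vb vd].
have [->|vc] := eqVneq v c; first by rewrite sc /m min_r ?subrr// ltW.
by rewrite s4// !inE !negb_or va vc vb vd.
Qed.

Lemma continuous_shear (a c b d : 'I_n) s v :
  continuous (fun x : polyhedron R n s => shear a c b d (val x) v).
Proof.
have cx := @continuous_coord R n s.
have cm e := @continuous_mulrn R _ _ (v == e) (continuous_minr (cx a) (cx c)).
apply: continuous_subr (cm c); apply: continuous_subr (cm a).
by apply: continuous_addr (cm d); apply: continuous_addr (cm b); exact: cx.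
Qed.

Lemma homeomorphic_shear (a c b d : 'I_n) s s' :
  uniq [:: a; c; b; d] -> unlinks a c b d s s' -> unlinks b d a c s' s ->
  homeomorphic (polyhedron R n s) (polyhedron R n s').
Proof.
move=> acbd ss' s's.
have bdac : uniq [:: b; d; a; c].
  by rewrite (_ : [:: b; d; a; c] = rot 2 [:: a; c; b; d])// rot_uniq.
pose f (x : polyhedron R n s) : polyhedron R n s' :=
  SigSub (mem_set (shearP acbd ss' (set_valP x)).1).
pose g (x : polyhedron R n s') : polyhedron R n s :=
  SigSub (mem_set (shearP bdac s's (set_valP x)).1).
exists f, g; split.
- by move=> x; apply: val_inj; exact: (shearP acbd ss' (set_valP x)).2.
- by move=> x; apply: val_inj; exact: (shearP bdac s's (set_valP x)).2.
- by apply: continuous_polyhedron => v; exact: continuous_shear.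
- by apply: continuous_polyhedron => v; exact: continuous_shear.
Qed.

Definition flip (q : nat * nat * nat * nat) (s : seq (seq nat)) :=
  let: (a, c, b, d) := q in
  [:: [:: a; b; d], [:: c; b; d] & [seq t <- s | ~~ ((a \in t) && (c \in t))]].

Definition flippable (q : nat * nat * nat * nat) (s : seq (seq nat)) :=
  let: (a, c, b, d) := q in
  [&& uniq [:: a; c; b; d], all (fun i => i < n)%N [:: a; c; b; d],
      unlinks a c b d s (flip q s) & unlinks b d a c (flip q s) s].

(** The last step compares [s'] with the flipped list up to mutual inclusion of
    faces, so that [s'] may list its triangles in any order. *)
Fixpoint flip_path (s : seq (seq nat)) (qs : seq (nat * nat * nat * nat)) s' :=
  if qs is q :: qs' then flippable q s && flip_path (flip q s) qs' s'
  else all (included_in s') s && all (included_in s) s'.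

Lemma eq_polyhedron s s' :
  all (included_in s') s -> all (included_in s) s' ->
  polyhedron R n s = polyhedron R n s'.
Proof.
move=> /allP ss' /allP s's; apply/seteqP; split=> x [x0 x1 [t ts xt]]; split=> //.
  by have [t' ? tt'] := included_inP (ss' _ ts); exists t' => // v /xt/tt'.
by have [t' ? tt'] := included_inP (s's _ ts); exists t' => // v /xt/tt'.
Qed.

Lemma flip_path_homeomorphic s qs s' :
  flip_path s qs s' -> homeomorphic (polyhedron R n s) (polyhedron R n s').
Proof.
elim: qs s => [s /andP[ss' s's]|[[[a c] b] d] qs IHqs s /andP[flq /IHqs]].
  by rewrite (eq_polyhedron ss' s's); exact: homeomorphic_refl.
apply: homeomorphic_trans.
case/and4P: flq => acbd /and5P[an cn bn dn _] H1 H2.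
apply: (@homeomorphic_shear (Ordinal an) (Ordinal cn) (Ordinal bn) (Ordinal dn)) => //.
Qed.

End Flip.

(** * Isomorphisms of complexes and of facet-ridge graphs *)
Definition has_universal_vertex n (s : seq (seq nat)) :=
  has (fun v => all (fun w => included_in s [:: v; w]) (iota 0 n)) (iota 0 n).

Lemma complex_iso_universal n s s' (sP : spanning n.+1 s)
    (s'P : spanning n.+1 s') :
  complex_iso (span_complex sP) (span_complex s'P) ->
  has_universal_vertex n.+1 s -> has_universal_vertex n.+1 s'.
Proof.
move=> [f [g fK gK] fE] /hasP[v]; rewrite mem_iota => vn /allP vP.
apply/hasP; exists (f (Ordinal vn) : nat); first by rewrite mem_iota /=.
apply/allP => w; rewrite mem_iota => wn.
have gn : val (g (Ordinal wn)) \in iota 0 n.+1 by rewrite mem_iota /=.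
have [t ts vgt] := included_inP (vP _ gn).
have : (f @: [set Ordinal vn; g (Ordinal wn)])%SET \in faces (span_complex s'P).
  rewrite -fE; apply: imset_f; rewrite /= inE; apply/hasP; exists t => //.
  by apply/fintype.subsetP => u; rewrite !inE => /orP[] /eqP->;
    apply: vgt; rewrite !inE eqxx ?orbT.
rewrite imsetU1 imset_set1 gK inE => /hasP[t' t's /fintype.subsetP sub].
apply/hasP; exists t' => //; rewrite /= andbT; apply/andP; split.
  by have := sub (f (Ordinal vn)); rewrite !inE eqxx => /(_ isT).
by have := sub (Ordinal wn); rewrite !inE eqxx orbT => /(_ isT).
Qed.

Definition meet_size (t t' : seq nat) := count (mem t') t.

(** For distinct triangles to be distinct facets, no two of the list may have
    all three vertices in common. *)
Definition triangle_list n (s : seq (seq nat)) :=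
  all (fun t => [&& uniq t, size t == 3 & all (fun i => i < n)%N t]) s &&
  pairwise (fun t t' => meet_size t t' != 3) s.

Definition adjacent (t t' : seq nat) := meet_size t t' == 2%N.

Definition same_adjacency (s s' : seq (seq nat)) :=
  (size s == size s') &&
  all (fun i => all (fun j => adjacent (nth [::] s i) (nth [::] s j) ==
                              adjacent (nth [::] s' i) (nth [::] s' j))
         (iota 0 (size s))) (iota 0 (size s)).

Lemma card_vset n (t : seq nat) :
  uniq t -> all (fun i => i < n)%N t -> #|vset n t| = size t.
Proof.
move=> ut /allP tn; rewrite cardE -(size_map val); apply/perm_size.
apply: uniq_perm => //; first by rewrite (map_inj_uniq val_inj) enum_uniq.
move=> i; apply/mapP/idP => [[j]|it].
  by rewrite mem_enum inE => jt ->.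
by exists (Ordinal (tn _ it)) => //; rewrite mem_enum inE.
Qed.

Section DualGraph.
Variables (n : nat) (s : seq (seq nat)).
Hypotheses (sP : spanning n.+1 s) (sT : triangle_list n.+1 s).
Let K := span_complex sP.
Let tri i := nth [::] s i.

Let tri_in (i : 'I_(size s)) : tri i \in s.
Proof. exact: mem_nth. Qed.

Let triP t : t \in s -> [/\ uniq t, size t = 3%N & all (fun i => i < n.+1)%N t].
Proof. by case/andP: sT => /allP + _ => /[apply] /and3P[? /eqP ? ?]. Qed.

Lemma card_vsetI t t' : t \in s ->
  #|vset n.+1 t :&: vset n.+1 t'|%SET = meet_size t t'.
Proof.
move=> /triP[ut _ tn]; rewrite /meet_size -size_filter -(@card_vset n.+1).
- by apply: eq_card => i; rewrite !inE mem_filter andbC.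
- exact: filter_uniq.
- by apply/allP => i; rewrite mem_filter => /andP[_]; exact: (allP tn).
Qed.

Lemma card_triangle t : t \in s -> #|vset n.+1 t| = 3%N.
Proof. by move=> /triP[ut <- tn]; exact: card_vset. Qed.

Lemma meet_size_distinct (i j : 'I_(size s)) :
  i != j -> meet_size (tri i) (tri j) != 3%N.
Proof.
case/andP: sT => _ /(pairwiseP [::]) pw.
have ms (k l : 'I_(size s)) : (k < l)%N -> meet_size (tri k) (tri l) != 3%N.
  by move=> kl; apply: pw; rewrite ?inE.
rewrite -val_eqE neq_ltn => /orP[ij|ji]; first exact: ms.
by rewrite -card_vsetI// finset.setIC card_vsetI//; exact: ms.
Qed.

Lemma is_facet_triangle (i : 'I_(size s)) : is_facet K (vset n.+1 (tri i)).
Proof.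
apply/maxsetP; split; first by rewrite inE; apply/hasP; exists (tri i).
move=> B; rewrite inE => /hasP[t ts Bt] iB; apply/eqP.
rewrite eq_sym eqEcard iB (card_triangle (tri_in i)).
by rewrite -(card_triangle ts) subset_leq_card.
Qed.

Definition triangle_facet (i : 'I_(size s)) : facet K :=
  Sub (vset n.+1 (tri i)) (is_facet_triangle i).

Lemma triangle_facet_inj : injective triangle_facet.
Proof.
move=> i j /(congr1 val) /= ij; apply/eqP; apply: contraT => /meet_size_distinct.
by rewrite -card_vsetI// -ij finset.setIid card_triangle.
Qed.

Lemma triangle_facet_onto F : exists i, triangle_facet i = F.
Proof.
case: F => F Fmax; have /maxsetP[] := Fmax.
rewrite inE => /hasP[t ts Ft] FP.
have ti : (index t s < size s)%N by rewrite index_mem.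
exists (Ordinal ti); apply: val_inj; rewrite /= /tri nth_index//.
by apply: FP => //; rewrite inE; apply/hasP; exists t.
Qed.

Lemma triangle_facet_bij : bijective triangle_facet.
Proof.
have [g gK] := choice triangle_facet_onto.
by exists g => // i; apply: triangle_facet_inj; rewrite gK.
Qed.

(** Two distinct triangles have a common ridge if and only if they meet in two
    vertices: the ridge is then their intersection. *)
Lemma triangle_facet_adj i j : facet_ridge_graph K (triangle_facet i)
  (triangle_facet j) = adjacent (tri i) (tri j).
Proof.
rewrite /adjacent /facet_ridge_graph (inj_eq triangle_facet_inj).
have [->|ij] /= := eqVneq i j.
  by rewrite -card_vsetI// finset.setIid card_triangle.
have := meet_size_distinct ij; rewrite -card_vsetI//.
set A := vset n.+1 (tri i); set B := vset n.+1 (tri j).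
have cA : #|A| = 3%N by exact: card_triangle.
have cB : #|B| = 3%N by exact: card_triangle.
have AB : (#|A :&: B|%SET <= 3)%N.
  by rewrite -cA; apply: subset_leq_card; exact: finset.subsetIl.
move=> AB3; apply/existsP/eqP => [[r]|AB2].
  rewrite /is_ridge_of /= => /andP[/andP[_ /existsP[v /andP[vA /eqP rA]]]].
  move=> /andP[_ /existsP[w /andP[wB /eqP rB]]].
  have : (r \subset A :&: B)%SET.
    by rewrite finset.subsetI {1}rA rB !finset.subsetDl.
  move/subset_leq_card; have := cardsD1 v A; rewrite vA cA -rA add1n.
  move=> -[<-] AB2; apply/eqP.
  by rewrite eqn_leq -ltnS ltn_neqAle AB3 AB AB2.
exists (A :&: B)%SET.
have ridge (C : {set 'I_n.+1}) : #|C| = 3%N -> (A :&: B \subset C)%SET ->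
    exists2 v, v \in C & (A :&: B)%SET = (C :\ v)%SET.
  move=> cC sC; have : (0 < #|C :\: (A :&: B)|%SET)%N.
    by rewrite cardsDS// cC AB2.
  move=> /card_gt0P[v]; rewrite finset.in_setD => /andP[vAB vC].
  exists v => //; apply/eqP; rewrite eqEcard finset.subsetD1 sC vAB /=.
  by have := cardsD1 v C; rewrite vC cC AB2 add1n => -[<-].
have [v vA ABv] := ridge A cA (finset.subsetIl _ _).
have [w wB ABw] := ridge B cB (finset.subsetIr _ _).
rewrite /is_ridge_of !(valP (triangle_facet _)) /=; apply/andP; split.
  by apply/existsP; exists v; rewrite vA -ABv eqxx.
by apply/existsP; exists w; rewrite wB -ABw eqxx.
Qed.

End DualGraph.

Lemma same_adjacency_graph_iso n s s' (sP : spanning n.+1 s)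
    (s'P : spanning n.+1 s') :
  triangle_list n.+1 s -> triangle_list n.+1 s' -> same_adjacency s s' ->
  graph_iso (facet_ridge_graph (span_complex sP))
            (facet_ridge_graph (span_complex s'P)).
Proof.
move=> sT s'T /andP[/eqP ss' /allP adj].
have [g gK Kg] := triangle_facet_bij sP sT.
have [g' g'K Kg'] := triangle_facet_bij s'P s'T.
exists (fun F => triangle_facet s'P s'T (cast_ord ss' (g F))).
  exists (fun F => triangle_facet sP sT (cast_ord (esym ss') (g' F))) => F.
    by rewrite g'K cast_ordK Kg.
  by rewrite gK cast_ordKV Kg'.
move=> F G; rewrite -{2}(Kg F) -{2}(Kg G) !triangle_facet_adj /=.
have lt_size (i : 'I_(size s)) : val i \in iota 0 (size s).
  by rewrite mem_iota /= add0n ltn_ord.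
by have /allP/(_ _ (lt_size (g G)))/eqP<- := adj _ (lt_size (g F)).
Qed.

(** * The circle as the boundary of a triangle *)

Lemma sphere_ray (R : realType) n (v : 'rV[R]_n.+1) :
  v != 0 -> exists2 k : R, 0 < k & sphere R n (k *: v).
Proof.
move=> v0; have N0 : 0 < \sum_i v ord0 i ^+ 2.
  rewrite lt_neqAle sumr_ge0 ?andbT => [|i _]; last exact: sqr_ge0.
  apply: contraNneq v0 => /esym/eqP; rewrite psumr_eq0 => [/allP v0|i _].
    apply/eqP/rowP => i; have := v0 i; rewrite mem_index_enum mxE => /(_ isT).
    by rewrite sqrf_eq0 => /eqP.
  exact: sqr_ge0.
exists (Num.sqrt (\sum_i v ord0 i ^+ 2))^-1; first by rewrite invr_gt0 sqrtr_gt0.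
rewrite /sphere /=; under eq_bigr do rewrite mxE exprMn.
by rewrite -mulr_sumr exprVn sqr_sqrtr ?ltW// mulVf ?gt_eqF.
Qed.

Lemma sphere_ray_unique (R : realType) n (v : 'rV[R]_n.+1) (k : R) :
  sphere R n v -> sphere R n (k *: v) -> 0 <= k -> k = 1.
Proof.
rewrite /sphere /= => v1; under eq_bigr do rewrite mxE exprMn.
by rewrite -mulr_sumr v1 mulr1 => /eqP; rewrite sqrf_eq1 => /orP[/eqP//|/eqP->]; lra.
Qed.

Lemma continuous_sphere_coord (R : realType) n j :
  continuous (fun u : sphere R n => val u ord0 j).
Proof.
move=> u.
apply: (@continuous_comp _ _ _ set_val (fun v : 'rV[R]_n.+1 => v ord0 j : R)).
  exact: initial_continuous.
exact: coord_continuous.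
Qed.

Section Fan.
Variable R : realType.
Implicit Types u v : 'rV[R]_2.

(** The rays (1,0), (0,1), (-1,-1) cut the plane into three cones.  Subtracting
    min (0, x, y) from (x, y, 0) gives the nonnegative coordinates, one of them
    zero, on the rays bounding the cone of (x, y); [fan_mass] is their sum. *)
Definition fan_gap u : R := Num.min 0 (Num.min (u ord0 0) (u ord0 1)).

Definition fan_mass u : R := u ord0 0 + u ord0 1 - fan_gap u *+ 3.

Definition fan_coord u (i : 'I_3) : R :=
  (nth 0 [:: u ord0 0; u ord0 1] i - fan_gap u) / fan_mass u.

Definition on_triangle (p : 'I_3 -> R) :=
  [/\ forall i, 0 <= p i, \sum_i p i = 1 & exists i, p i = 0].

Lemma row2P u v : u ord0 0 = v ord0 0 -> u ord0 1 = v ord0 1 -> u = v.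
Proof.
move=> uv0 uv1; apply/rowP => i.
case: i => -[|[|//]] i.
  by have -> : Ordinal i = 0 by [apply: ord_inj]; exact: uv0.
by have -> : Ordinal i = 1 by [apply: ord_inj]; exact: uv1.
Qed.

Lemma sum3 (p : 'I_3 -> R) : \sum_i p i = p 0 + p 1 + p 2.
Proof.
rewrite !big_ord_recl big_ord0 addr0 addrA.
by congr (p _ + p _ + p _); apply: ord_inj.
Qed.

Lemma fan_gapP u : [/\ fan_gap u <= 0, fan_gap u <= u ord0 0,
  fan_gap u <= u ord0 1
  & fan_gap u = 0 \/ fan_gap u = u ord0 0 \/ fan_gap u = u ord0 1].
Proof.
rewrite /fan_gap; case: (leP (u ord0 0)) => h; case: (leP 0) => h' /=; split;
  first [lra|by left|by right; left|by right; right].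
Qed.

Lemma fan_mass_gt0 u : u != 0 -> 0 < fan_mass u.
Proof.
move=> u0; rewrite /fan_mass lt_neqAle; apply/andP; split; last first.
  by have [] := fan_gapP u; lra.
apply: contraNneq u0 => mass0; have [g0 gu0 gu1 gE] := fan_gapP u.
by apply/eqP/row2P; rewrite mxE; lra.
Qed.

Lemma fan_gapZ (k : R) u : 0 < k -> fan_gap (k *: u) = k * fan_gap u.
Proof.
move=> k0; rewrite /fan_gap !mxE -minr_pMr ?ltW//.
by rewrite -{1}(mulr0 k) -minr_pMr ?ltW.
Qed.

Lemma fan_coordZ (k : R) u : 0 < k -> fan_coord (k *: u) = fan_coord u.
Proof.
move=> k0; apply/funext => i; rewrite /fan_coord /fan_mass fan_gapZ// !mxE.
have -> : nth 0 [:: k * u ord0 0; k * u ord0 1] i =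
    k * nth 0 [:: u ord0 0; u ord0 1] i.
  by case: i => -[|[|[|]]]//= _; rewrite mulr0.
rewrite -mulrnAr -mulrDr -!mulrBr invfM mulrACA divff ?mul1r//.
by rewrite gt_eqF.
Qed.

Lemma sphere_neq0 n (v : 'rV[R]_n.+1) : sphere R n v -> v != 0.
Proof.
move=> v1; apply/eqP => v0; move: v1; rewrite /sphere /= v0.
rewrite big1 => [/esym/eqP|i _]; last by rewrite mxE expr0n.
by rewrite oner_eq0.
Qed.

Lemma fan_coord_triangle u : u != 0 -> on_triangle (fan_coord u).
Proof.
move=> /fan_mass_gt0 m0; have [g0 gu0 gu1 gE] := fan_gapP u; split.
- move=> i; rewrite divr_ge0 ?(ltW m0)// subr_ge0.
  by case: i => -[|[|[|]]].
- rewrite sum3 /fan_coord /= -!mulrDl.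
  set N := (X in X / _); have -> : N = fan_mass u by rewrite /N /fan_mass; ring.
  by rewrite divff// gt_eqF.
- rewrite /fan_coord; case: gE => [->|[->|->]]; [exists 2|exists 0|exists 1];
  by rewrite /= subrr mul0r.
Qed.

(** The point with the given coordinates on the three rays. *)
Definition fan_point (p : 'I_3 -> R) : 'rV[R]_2 :=
  \row_i (nth 0 [:: p 0; p 1] i - p 2).

Lemma fan_coordK u : u != 0 -> fan_mass u *: fan_point (fan_coord u) = u.
Proof.
move=> /fan_mass_gt0 m0; have m : fan_mass u != 0 by rewrite gt_eqF.
apply: row2P; rewrite !mxE /fan_coord /=; field; exact: m.
Qed.

Lemma fan_pointK p : on_triangle p ->
  fan_point p != 0 /\ fan_coord (fan_point p) = p.
Proof.
move=> [p0 p1 [i0 pi0]]; rewrite sum3 in p1.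
have gE : fan_gap (fan_point p) = - p 2.
  have p00 := p0 0; have p01 := p0 1; have p02 := p0 2.
  rewrite /fan_gap !mxE /=.
  have : p 0 = 0 \/ p 1 = 0 \/ p 2 = 0.
    move: pi0; case: i0 => -[|[|[|//]]] i pi; [left|right; left|right; right];
    by rewrite -[RHS]pi; congr p; apply: ord_inj.
  by case: (leP (p 0 - _)) => ?; case: (leP 0) => ?; lra.
have mE : fan_mass (fan_point p) = 1 by rewrite /fan_mass gE !mxE /=; lra.
split.
  apply/eqP => f0; move: mE; rewrite f0 /fan_mass /fan_gap !mxE !minxx; lra.
apply/funext => i; rewrite /fan_coord gE mE !mxE /= divr1.
by case: i => -[|[|[|//]]] i /=; rewrite opprK ?subrK ?add0r; congr p; apply: ord_inj.
Qed.

Lemma continuous_fan_coord i :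
  continuous (fun u : sphere R 1 => fan_coord (val u) i).
Proof.
have cu := @continuous_sphere_coord R 1.
have c0 : continuous (fun _ : sphere R 1 => 0 : R) by exact: cst_continuous.
have cg : continuous (fun u : sphere R 1 => fan_gap (val u)).
  by rewrite /fan_gap; apply: continuous_minr => //; exact: continuous_minr.
apply: continuous_divr.
- by move=> u; rewrite gt_eqF// fan_mass_gt0//; exact: sphere_neq0 (set_valP u).
- apply: continuous_subr cg; case: i => -[|[|[|//]]] i /=; [exact: cu|exact: cu|exact: c0].
- apply: continuous_subr; first exact: continuous_addr (cu 0) (cu 1).
  exact: continuous_mulrn cg.
Qed.

End Fan.

(** * The torus as a three by three grid *)

Definition grid_index (i j : nat) : nat := i %% 3 * 3 + j %% 3.

Definition torus_grid : seq (seq nat) :=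
  [seq [:: grid_index ij.1 ij.2; if b then grid_index ij.1.+1 ij.2
           else grid_index ij.1 ij.2.+1; grid_index ij.1.+1 ij.2.+1]
  | ij <- [seq (i, j) | i <- iota 0 3, j <- iota 0 3], b <- [:: true; false]].

Ltac case_min :=
  match goal with |- context [Num.min ?x ?y] =>
    lazymatch x with context [Num.min _ _] => fail | _ =>
    lazymatch y with context [Num.min _ _] => fail | _ =>
    case: (leP x y) => ? end end end.
Ltac case_max :=
  match goal with |- context [Num.max ?x ?y] =>
    lazymatch x with context [Num.max _ _] => fail | _ =>
    lazymatch y with context [Num.max _ _] => fail | _ =>
    case: (leP x y) => ? end end end.
Ltac minmax := repeat first [case_min|case_max]; lra.

Section Staircase.
Variable R : realType.
Implicit Types p q : 'I_3 -> R.

Let n3P (i : 'I_3) : [/\ i + 1 + 1 = i - 1, i - 1 + 1 = i, i - 1 - 1 = i + 1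
  & i + 1 - 1 = i].
Proof. by case: i => -[|[|[|//]]] i; split; apply: ord_inj. Qed.

Lemma grid_proof (i j : 'I_3) : (grid_index i j < 9)%N.
Proof. rewrite /grid_index; lia. Qed.

Definition grid (i j : 'I_3) : 'I_9 := Ordinal (grid_proof i j).

Definition grid_row (k : 'I_9) : 'I_3 := inZp (k %/ 3).
Definition grid_col (k : 'I_9) : 'I_3 := inZp k.

Lemma gridK k : grid (grid_row k) (grid_col k) = k.
Proof.
apply: ord_inj; rewrite /= /grid_index /= !modn_mod modn_small; first lia.
have := ltn_ord k; lia.
Qed.

Lemma grid_rowK i j : grid_row (grid i j) = i.
Proof.
apply: ord_inj; rewrite /= /grid_index; have := ltn_ord i; have := ltn_ord j.
lia.
Qed.

Lemma grid_colK i j : grid_col (grid i j) = j.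
Proof.
apply: ord_inj; rewrite /= /grid_index; have := ltn_ord i; have := ltn_ord j.
lia.
Qed.

Lemma sum_grid (f : 'I_9 -> R) : \sum_k f k = \sum_i \sum_j f (grid i j).
Proof.
rewrite pair_big (reindex (fun ij => grid ij.1 ij.2))//.
exists (fun k => (grid_row k, grid_col k)) => [[i j]|k] _ /=.
  by rewrite grid_rowK grid_colK.
exact: gridK.
Qed.

Lemma sum3_from (f : 'I_3 -> R) i : \sum_k f k = f i + f (i + 1) + f (i - 1).
Proof.
rewrite (bigD1 i)//= (bigD1 (i + 1))/=; last first.
  by case: i => -[|[|[|//]]] i.
rewrite (bigD1 (i - 1))/=; last first.
  by case: i => -[|[|[|//]]] i.
rewrite big1 ?addr0 ?addrA// => k.
by case: i k => -[|[|[|//]]] i [[|[|[|//]]] k].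
Qed.

Lemma from3 (i k : 'I_3) : [\/ k = i, k = i + 1 | k = i - 1].
Proof.
by case: i k => -[|[|[|//]]] i [[|[|[|//]]] k];
   first [constructor 1; apply: ord_inj; reflexivity
         |constructor 2; apply: ord_inj; reflexivity
         |constructor 3; apply: ord_inj; reflexivity].
Qed.

(** Let a, a', a'' be the coordinates of p at i, i + 1, i - 1, and b, b', b''
    those of q at j, j + 1, j - 1.  The value is the coordinate at the vertex
    (i, j) of the point of the grid lying over (p, q).  In a square having
    (i, j) on its diagonal this coordinate is min a b, the sum of max 0 (a + b - 1)
    and of one of the two minima; in the other squares at (i, j) both minima
    vanish and the coordinate is max 0 (a + b - 1). *)
Definition stair_val (a a' a'' b b' b'' : R) : R :=
  Num.max 0 (a + b - 1) + Num.min (Num.min a a') (Num.min b b') +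
  Num.min (Num.min a a'') (Num.min b b'').

(** Here a' = 1 - a and b' = 1 - b, and min a b = max 0 (a + b - 1) +
    min (a, b, 1 - a, 1 - b). *)
Lemma stair_val_low (a a' b b' : R) : 0 <= a -> 0 <= a' -> 0 <= b -> 0 <= b' ->
  a + a' = 1 -> b + b' = 1 -> stair_val a a' 0 b b' 0 = Num.min a b.
Proof.
move=> a0 a0' b0 b0' aa bb; rewrite /stair_val (min_r a0) (min_r b0) minxx.
minmax.
Qed.

Lemma stair_val_swap (a a' a'' b b' b'' : R) :
  stair_val a a' a'' b b' b'' = stair_val a a'' a' b b'' b'.
Proof. by rewrite /stair_val addrAC. Qed.

Lemma stair_val_side (a a' b b' : R) : 0 <= a -> 0 <= a' -> 0 <= b -> 0 <= b' ->
  stair_val a 0 a' b b' 0 = Num.max 0 (a + b - 1).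
Proof.
move=> a0 a0' b0 b0'; rewrite /stair_val (min_r a0) (min_r b0).
rewrite [Num.min 0 _]min_l ?le_min ?b0// [Num.min _ 0]min_r ?le_min ?a0//.
by rewrite !addr0.
Qed.

Lemma stair_val_off (a' a'' b b' b'' : R) : 0 <= a' -> 0 <= a'' ->
  0 <= b -> 0 <= b' -> 0 <= b'' -> b <= 1 -> stair_val 0 a' a'' b b' b'' = 0.
Proof.
move=> a0 a0' b0 b0' b0'' b1; rewrite /stair_val (min_l a0) (min_l a0').
by rewrite ![Num.min 0 _]min_l ?le_min ?b0 ?b0' ?b0''// max_l ?addr0 ?add0r ?subr_le0.
Qed.

Lemma stair_valC (a a' a'' b b' b'' : R) :
  stair_val a a' a'' b b' b'' = stair_val b b' b'' a a' a''.
Proof.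
by rewrite /stair_val (addrC a) (minC (Num.min a a')) (minC (Num.min a a'')).
Qed.

Definition stair p q (k : 'I_9) : R :=
  let i := grid_row k in let j := grid_col k in
  stair_val (p i) (p (i + 1)) (p (i - 1)) (q j) (q (j + 1)) (q (j - 1)).

Lemma stair_grid p q i j : stair p q (grid i j) =
  stair_val (p i) (p (i + 1)) (p (i - 1)) (q j) (q (j + 1)) (q (j - 1)).
Proof. by rewrite /stair grid_rowK grid_colK. Qed.

(** The coordinates of the point over (p, q) in the square with corners (i, j)
    and (i + 1, j + 1), which contains it since p vanishes at i - 1 and q at
    j - 1.  Which of the two middle coordinates is zero tells on which side of
    the diagonal the point lies. *)
Lemma stair_cell p q i j : on_triangle p -> on_triangle q ->
  p (i - 1) = 0 -> q (j - 1) = 0 ->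
  [/\ stair p q (grid i j) = Num.min (p i) (q j),
      stair p q (grid (i + 1) (j + 1)) = Num.min (p (i + 1)) (q (j + 1)),
      stair p q (grid (i + 1) j) = Num.max 0 (p (i + 1) - q (j + 1)),
      stair p q (grid i (j + 1)) = Num.max 0 (q (j + 1) - p (i + 1))
    & forall k, stair p q (grid (i - 1) k) = 0 /\ stair p q (grid k (j - 1)) = 0].
Proof.
move=> [p0 p1 _] [q0 q1 _] pi qj.
rewrite (sum3_from _ i) pi in p1; rewrite (sum3_from _ j) qj in q1.
have := (p0 i, p0 (i + 1), q0 j, q0 (j + 1)) => -[[[pi0 pi1] qj0] qj1].
have [ip imp imm ipm] := n3P i; have [jp jmp jmm jpm] := n3P j.
rewrite !stair_grid ip ipm jp jpm pi qj; split.
- by apply: stair_val_low => //; lra.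
- by rewrite stair_val_swap; apply: stair_val_low => //; lra.
- by rewrite stair_val_side//; congr Num.max; lra.
- by rewrite stair_val_swap stair_val_side//; congr Num.max; lra.
move=> k; rewrite !stair_grid imp imm jmp jmm pi qj; split.
  by apply: stair_val_off => //; have [->|->|->] := from3 j k; lra.
rewrite stair_valC.
by apply: stair_val_off => //; have [->|->|->] := from3 i k; lra.
Qed.

Lemma zero_before p : on_triangle p -> exists i, p (i - 1) = 0.
Proof. by move=> [_ _ [i pi0]]; exists (i + 1); have [_ _ _ ->] := n3P i. Qed.

(** The two coordinate projections recover p and q, hence the map from pairs
    (p, q) to the grid is injective. *)
Lemma stair_row p q i : on_triangle p -> on_triangle q ->
  \sum_j stair p q (grid i j) = p i.
Proof.
move=> tp tq; have [i0 pi0] := zero_before tp; have [j0 qj0] := zero_before tq.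
have [s00 s11 s10 s01 s0] := stair_cell tp tq pi0 qj0.
move: tp tq => [p0 p1 _] [q0 q1 _].
rewrite (sum3_from _ i0) pi0 in p1; rewrite (sum3_from _ j0) qj0 in q1.
rewrite (sum3_from _ j0) (s0 i).2.
have [->|->|->] := from3 i0 i.
- rewrite s00 s01; minmax.
- rewrite s10 s11; minmax.
- by rewrite !(s0 _).1 pi0; lra.
Qed.

Lemma stair_col p q j : on_triangle p -> on_triangle q ->
  \sum_i stair p q (grid i j) = q j.
Proof.
move=> tp tq; have [i0 pi0] := zero_before tp; have [j0 qj0] := zero_before tq.
have [s00 s11 s10 s01 s0] := stair_cell tp tq pi0 qj0.
move: tp tq => [p0 p1 _] [q0 q1 _].
rewrite (sum3_from _ i0) pi0 in p1; rewrite (sum3_from _ j0) qj0 in q1.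
rewrite (sum3_from _ i0) (s0 j).1.
have [->|->|->] := from3 j0 j.
- rewrite s00 s10; minmax.
- rewrite s01 s11; minmax.
- by rewrite !(s0 _).2 qj0; lra.
Qed.

Definition cell_triangle (b : bool) (i j : 'I_3) : seq 'I_9 :=
  [:: grid i j; if b then grid (i + 1) j else grid i (j + 1);
      grid (i + 1) (j + 1)].

Lemma grid_indexS i j : [/\ grid_index i.+1 j = grid_index (i.+1 %% 3) j,
  grid_index i j.+1 = grid_index i (j.+1 %% 3)
  & grid_index i.+1 j.+1 = grid_index (i.+1 %% 3) (j.+1 %% 3)].
Proof. by rewrite /grid_index !modn_mod. Qed.

Lemma torus_gridP t :
  t \in torus_grid <-> exists b i j, t = map val (cell_triangle b i j).
Proof.
split=> [/allpairsPdep[_ [b [/allpairsPdep[i [j [+ + ->]]] _ ->]]]|].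
  rewrite !mem_iota => lti ltj; exists b, (Ordinal lti), (Ordinal ltj).
  rewrite /cell_triangle /=; have [-> -> ->] := grid_indexS i j.
  by case: b => /=; rewrite !addn1 ?modn_mod.
move=> [b [i [j ->]]]; apply/allpairsPdep; exists (nat_of_ord i, nat_of_ord j), b; split.
- by apply/allpairsPdep; exists (nat_of_ord i), (nat_of_ord j); rewrite !mem_iota /= !ltn_ord.
- by case: b.
- rewrite /cell_triangle /=; have [-> -> ->] := grid_indexS i j.
  by case: b => /=; rewrite !addn1 ?modn_mod.
Qed.

Lemma stair_polyhedron p q : on_triangle p -> on_triangle q ->
  polyhedron R 9 torus_grid (stair p q).
Proof.
move=> tp tq; have [i0 pi0] := zero_before tp; have [j0 qj0] := zero_before tq.
have [s00 s11 s10 s01 s0] := stair_cell tp tq pi0 qj0.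
have [p0 p1 _] := tp; have [q0 q1 _] := tq.
have posS i j : 0 <= stair p q (grid i j).
  have [->|->|->] := from3 i0 i; last by rewrite (s0 _).1.
    have [->|->|->] := from3 j0 j; last by rewrite (s0 _).2.
      by rewrite s00 le_min p0 q0.
    by rewrite s01 le_max lexx.
  have [->|->|->] := from3 j0 j; last by rewrite (s0 _).2.
    by rewrite s10 le_max lexx.
  by rewrite s11 le_min p0 q0.
split.
- by move=> k; rewrite -(gridK k).
- by rewrite sum_grid -p1; apply: eq_bigr => i _; exact: stair_row.
have [b bP] : exists b : bool, if b then q (j0 + 1) <= p (i0 + 1)
    else p (i0 + 1) <= q (j0 + 1).
  by have [qp|/ltW pq] := leP (q (j0 + 1)) (p (i0 + 1)); [exists true|exists false].
exists (map val (cell_triangle b i0 j0)).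
  by apply/torus_gridP; exists b, i0, j0.
move=> k; rewrite -(gridK k) => kN0; apply: map_f; move: kN0; rewrite !inE.
move: (grid_row k) (grid_col k) => i j.
have [->|->|->] := from3 i0 i; last by rewrite (s0 _).1 eqxx.
  have [->|->|->] := from3 j0 j; last by rewrite (s0 _).2 eqxx.
    by rewrite eqxx.
  case: b bP => bP; last by rewrite eqxx orbT.
  by rewrite s01 max_l ?eqxx// subr_le0.
have [->|->|->] := from3 j0 j; last by rewrite (s0 _).2 eqxx.
  case: b bP => bP; first by rewrite eqxx orbT.
  by rewrite s10 max_l ?eqxx// subr_le0.
by rewrite eqxx !orbT.
Qed.

(** A point of the grid is the image of its pair of marginals. *)
Lemma stair_onto (x : {ptws 'I_9 -> R}) : polyhedron R 9 torus_grid x ->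
  exists p q, [/\ on_triangle p, on_triangle q & stair p q = x].
Proof.
move=> [x0 x1 [t /torus_gridP[b [i [j ->]]] xt]].
pose p k := \sum_l x (grid k l); pose q l := \sum_k x (grid k l).
have off k l : grid k l \notin cell_triangle b i j -> x (grid k l) = 0.
  by apply: contraNeq => /xt; rewrite (mem_map val_inj).
have gridE k l k' l' : (grid k l == grid k' l') = (k == k') && (l == l').
  apply/eqP/andP => [e|[/eqP-> /eqP->//]].
  have := congr1 grid_row e; have := congr1 grid_col e.
  by rewrite !grid_rowK !grid_colK => -> ->.
have neq3 (k : 'I_3) : [/\ (k - 1 == k) = false, (k - 1 == k + 1) = false,
    (k + 1 == k) = false & (k == k + 1) = false].
  by case: k => -[|[|[|//]]] k.
have [imi imp ipi iip] := neq3 i; have [jmj jmp jpj jjp] := neq3 j.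
have xi k : x (grid (i - 1) k) = 0.
  by apply: off; rewrite !inE; case: (b); rewrite !gridE imi imp.
have xj k : x (grid k (j - 1)) = 0.
  by apply: off; rewrite !inE; case: (b); rewrite !gridE jmj jmp !andbF.
have xb : (if b then x (grid i (j + 1)) else x (grid (i + 1) j)) = 0.
  by case: (b) off => off; apply: off; rewrite !inE !gridE ?jpj ?jjp ?iip ?ipi ?andbF.
have pE k : p k = x (grid k j) + x (grid k (j + 1)).
  by rewrite /p (sum3_from _ j) xj addr0.
have qE l : q l = x (grid i l) + x (grid (i + 1) l).
  by rewrite /q (sum3_from _ i) xi addr0.
have tp : on_triangle p.
  split=> [k||]; first by apply: sumr_ge0.
    by rewrite -x1 sum_grid.
  by exists (i - 1); rewrite pE !xi addr0.
have tq : on_triangle q.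
  split=> [k||]; first by apply: sumr_ge0.
    by rewrite -x1 sum_grid exchange_big.
  by exists (j - 1); rewrite qE !xj addr0.
exists p, q; split=> //.
have pi : p (i - 1) = 0 by rewrite pE !xi addr0.
have qj : q (j - 1) = 0 by rewrite qE !xj addr0.
have [s00 s11 s10 s01 s0] := stair_cell tp tq pi qj.
have := (x0 (grid i j), x0 (grid i (j + 1)), x0 (grid (i + 1) j),
         x0 (grid (i + 1) (j + 1))) => -[[[x00 x01] x10] x11].
apply/funext => k; rewrite -(gridK k).
move: (grid_row k) (grid_col k) => {}k l.
have [->|->|->] := from3 i k; last by rewrite (s0 _).1 xi.
  have [->|->|->] := from3 j l; last by rewrite (s0 _).2 xj.
    by rewrite s00 pE qE; case: (b) xb => xb; minmax.
  by rewrite s01 pE qE; case: (b) xb => xb; minmax.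
have [->|->|->] := from3 j l; last by rewrite (s0 _).2 xj.
  by rewrite s10 pE qE; case: (b) xb => xb; minmax.
by rewrite s11 pE qE; case: (b) xb => xb; minmax.
Qed.

Lemma continuous_stair_val (X : topologicalType) (a a' a'' b b' b'' : X -> R) :
  continuous a -> continuous a' -> continuous a'' ->
  continuous b -> continuous b' -> continuous b'' ->
  continuous
    (fun x => stair_val (a x) (a' x) (a'' x) (b x) (b' x) (b'' x)).
Proof.
move=> ca ca' ca'' cb cb' cb''.
have cst (r : R) : continuous (fun _ : X => r) by exact: cst_continuous.
have cs := continuous_subr (continuous_addr ca cb) (cst 1).
have c1 := continuous_maxr (cst 0) cs.
have c2 := continuous_minr (continuous_minr ca ca') (continuous_minr cb cb').
have c3 := continuous_minr (continuous_minr ca ca'') (continuous_minr cb cb'').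
exact: continuous_addr (continuous_addr c1 c2) c3.
Qed.

Definition stair_torus (uw : torus R) : polyhedron R 9 torus_grid :=
  SigSub (mem_set (stair_polyhedron
    (fan_coord_triangle (sphere_neq0 (set_valP uw.1)))
    (fan_coord_triangle (sphere_neq0 (set_valP uw.2))))).

(** Equal coordinates mean that the points lie on one ray, which meets the
    circle once. *)
Lemma fan_coord_sphere_inj (u w : sphere R 1) :
  fan_coord (val u) = fan_coord (val w) -> u = w.
Proof.
move=> uw; apply: val_inj.
have u1 := set_valP u; have w1 := set_valP w.
have u0 := sphere_neq0 u1; have w0 := sphere_neq0 w1.
have mu := fan_mass_gt0 u0; have mw := fan_mass_gt0 w0.
pose k := fan_mass (val u) / fan_mass (val w).
have uE : val u = k *: val w.
  rewrite -{1}(fan_coordK u0) uw -{2}(fan_coordK w0) scalerA /k.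
  by rewrite mulfVK// gt_eqF.
have k1 : k = 1.
  apply: (sphere_ray_unique w1); first by rewrite -uE.
  by rewrite divr_ge0// ltW.
by rewrite uE k1 scale1r.
Qed.

Lemma fan_coord_sphere_onto p :
  on_triangle p -> exists u : sphere R 1, fan_coord (val u) = p.
Proof.
move=> /fan_pointK[f0 fE]; have [k k0 kf] := sphere_ray f0.
by exists (SigSub (mem_set kf)) => /=; rewrite fan_coordZ.
Qed.

Theorem torus_grid_homeomorphic :
  homeomorphic (torus R) (polyhedron R 9 torus_grid).
Proof.
apply: (@compact_hausdorff_homeomorphic _ _ stair_torus).
- exact: compact_torus.
- exact: polyhedron_hausdorff.
- apply: continuous_polyhedron => k /=.
  have cp i : continuous (fun uw : torus R => fan_coord (val uw.1) i).
    move=> uw; apply: (@continuous_comp _ _ _ fst (fun u : sphere R 1 => fan_coord (val u) i)).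
      exact: cvg_fst.
    exact: continuous_fan_coord.
  have cq i : continuous (fun uw : torus R => fan_coord (val uw.2) i).
    move=> uw; apply: (@continuous_comp _ _ _ snd (fun u : sphere R 1 => fan_coord (val u) i)).
      exact: cvg_snd.
    exact: continuous_fan_coord.
  by rewrite /stair; apply: continuous_stair_val.
- move=> [u w] [u' w'] /(congr1 val) /= E.
  have tr (v : sphere R 1) := fan_coord_triangle (sphere_neq0 (set_valP v)).
  congr (_, _); apply: fan_coord_sphere_inj; apply/funext => i.
    by rewrite -(stair_row i (tr u) (tr w)) E stair_row; try exact: tr.
  by rewrite -(stair_col i (tr u) (tr w)) E stair_col; try exact: tr.
- move=> x; have [p [q [tp tq pqx]]] := stair_onto (set_valP x).
  have [u up] := fan_coord_sphere_onto tp; have [w wq] := fan_coord_sphere_onto tq.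
  by exists (u, w); apply: val_inj; rewrite /= up wq.
Qed.

End Staircase.

(** * The projective plane as a subdivided octahedron modulo antipodes *)

(** The vertices 0, 1, 2 stand for the axes x, y, z, and 3 to 8 for the lines
    through x + y, x - y, x + z, x - z, y + z, y - z, that is, for the midpoints
    of the edges of the octahedron up to sign.  The first twelve triangles are
    the corners of the faces, the last four their middle parts. *)
Definition projective_grid : seq (seq nat) :=
  [:: [:: 0; 3; 5]; [:: 0; 3; 6]; [:: 0; 4; 5]; [:: 0; 4; 6];
      [:: 1; 3; 7]; [:: 1; 3; 8]; [:: 1; 4; 7]; [:: 1; 4; 8];
      [:: 2; 5; 7]; [:: 2; 5; 8]; [:: 2; 6; 7]; [:: 2; 6; 8];
      [:: 3; 5; 7]; [:: 3; 6; 8]; [:: 4; 5; 8]; [:: 4; 6; 7]]%N.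

Section Octahedron.
Variable R : realType.
Implicit Types (a b c : R) (u w : 'rV[R]_3) (s t : bool).

(** On the octahedral sphere of the l1 norm, a face with nonnegative coordinates
    a, b, c is cut into a corner a >= b + c, where the barycentric coordinates
    are a - b - c, 2b, 2c, two similar corners, and a middle triangle, where they
    are a + b - c, a + c - b, b + c - a.  [corner_coord] and [edge_coord] extend
    these to all of space, homogeneously and evenly; the difference
    `|a + b| - `|a - b| is twice the minimum of `|a| and `|b| if a and b have the
    same sign, and is not positive otherwise, so that a midpoint gets a positive
    coordinate only in the faces containing it. *)
Definition corner_coord a b c : R := Num.max 0 (`|a| - `|b| - `|c|).

Definition edge_coord a b c : R :=
  Num.max 0 (Num.min (`|a + b| - `|a - b|) (`|a + b| - `|c|)).

Definition oct_coord u (k : nat) : R :=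
  let x := u ord0 0 in let y := u ord0 1 in let z := u ord0 2 in
  nth 0 [:: corner_coord x y z; corner_coord y x z; corner_coord z x y;
            edge_coord x y z; edge_coord x (- y) z;
            edge_coord x z y; edge_coord x (- z) y;
            edge_coord y z x; edge_coord y (- z) x] k.

Definition norm1 u : R := `|u ord0 0| + `|u ord0 1| + `|u ord0 2|.

(** Up to sign every vector has this form with nonnegative a, b, c, and the two
    signs name the face of the octahedron modulo antipodes; [mid_coord] is what
    remains of [edge_coord] inside that face. *)
Definition signed_row s t a b c : 'rV[R]_3 :=
  \row_i nth 0 [:: a; (-1) ^+ s * b; (-1) ^+ t * c] i.

Definition mid_coord a b c : R :=
  Num.max 0 (Num.min (Num.min a b *+ 2) (a + b - c)).

Definition signed_coord s t a b c (k : nat) : R :=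
  nth 0 [:: corner_coord a b c; corner_coord b a c; corner_coord c a b;
            if s then 0 else mid_coord a b c; if s then mid_coord a b c else 0;
            if t then 0 else mid_coord a c b; if t then mid_coord a c b else 0;
            if s (+) t then 0 else mid_coord b c a;
            if s (+) t then mid_coord b c a else 0] k.

Lemma edge_coord_pos a b c : 0 <= a -> 0 <= b -> 0 <= c ->
  edge_coord a b c = mid_coord a b c.
Proof.
move=> a0 b0 c0; rewrite /edge_coord /mid_coord (ger0_norm c0).
rewrite (ger0_norm (addr_ge0 a0 b0)); congr (Num.max 0 (Num.min _ _)).
case: (leP a b) => ab; last by rewrite ger0_norm ?subr_ge0 ?(ltW ab)//; lra.
by rewrite ler0_norm ?subr_le0//; lra.
Qed.

Lemma edge_coord_neg a b c : 0 <= a -> 0 <= b -> edge_coord a (- b) c = 0.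
Proof.
move=> a0 b0; rewrite /edge_coord opprK (ger0_norm (addr_ge0 a0 b0)).
rewrite max_l// ge_min; apply/orP; left; rewrite subr_le0.
by rewrite (le_trans (ler_normB _ _))// !ger0_norm.
Qed.

Lemma edge_coordNN a b c : edge_coord (- a) (- b) c = edge_coord a b c.
Proof. by rewrite /edge_coord -opprD normrN opprK [- a + b]addrC distrC. Qed.

Lemma edge_coordN a b c : edge_coord a b (- c) = edge_coord a b c.
Proof. by rewrite /edge_coord normrN. Qed.

Lemma row3P u w : u ord0 0 = w ord0 0 -> u ord0 1 = w ord0 1 ->
  u ord0 2 = w ord0 2 -> u = w.
Proof.
move=> uw0 uw1 uw2; apply/rowP => i; case: i => -[|[|[|//]]] i.
- by have -> : Ordinal i = 0 by [apply: ord_inj]; exact: uw0.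
- by have -> : Ordinal i = 1 by [apply: ord_inj]; exact: uw1.
- by have -> : Ordinal i = 2 by [apply: ord_inj]; exact: uw2.
Qed.

Lemma oct_coordN u : oct_coord (- u) = oct_coord u.
Proof.
apply/funext => k; rewrite /oct_coord !mxE !edge_coordNN !edge_coordN.
by rewrite /corner_coord !normrN.
Qed.

Lemma oct_coord_signed s t a b c : 0 <= a -> 0 <= b -> 0 <= c ->
  oct_coord (signed_row s t a b c) = signed_coord s t a b c.
Proof.
move=> a0 b0 c0; apply/funext => k; rewrite /oct_coord /signed_coord !mxE /=.
have N1 x y z : corner_coord (- x) y z = corner_coord x y z.
  by rewrite /corner_coord normrN.
have N2 x y z : corner_coord x (- y) z = corner_coord x y z.
  by rewrite /corner_coord normrN.
have N3 x y z : corner_coord x y (- z) = corner_coord x y z.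
  by rewrite /corner_coord normrN.
have E x y z : edge_coord (- x) y z = edge_coord x (- y) z.
  by rewrite -edge_coordNN opprK.
by case: s t => -[]; rewrite /= ?expr0 ?expr1 ?mul1r ?mulN1r ?N1 ?N2 ?N3 ?opprK
   ?E ?opprK ?edge_coordN ?edge_coord_neg ?edge_coord_pos.
Qed.

Lemma signed_rowP u : exists s t (e : bool),
  u = (-1) ^+ e *: signed_row s t `|u ord0 0| `|u ord0 1| `|u ord0 2|.
Proof.
pose e := u ord0 0 < 0; exists (e (+) (u ord0 1 < 0)), (e (+) (u ord0 2 < 0)), e.
apply: row3P; rewrite !mxE /= ?mulrA -?signr_addb ?addbA ?addbb ?addFb;
  by rewrite -?numEsign // -realEsign ?num_real.
Qed.

(** The four pieces of a face. *)
Lemma regimes a b c : 0 <= a -> 0 <= b -> 0 <= c ->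
  [\/ b + c <= a, a + c <= b, a + b <= c
    | [/\ a <= b + c, b <= a + c & c <= a + b]].
Proof.
move=> a0 b0 c0; have [|h1] := leP (b + c) a; first by constructor 1.
have [|h2] := leP (a + c) b; first by constructor 2.
have [|h3] := leP (a + b) c; first by constructor 3.
by constructor 4; rewrite !ltW.
Qed.

Definition coord_values a b c : seq R :=
  [:: corner_coord a b c; corner_coord b a c; corner_coord c a b;
      mid_coord a b c; mid_coord a c b; mid_coord b c a].

Lemma coord_values_corner0 a b c : 0 <= a -> 0 <= b -> 0 <= c -> b + c <= a ->
  coord_values a b c = [:: a - b - c; 0; 0; b *+ 2; c *+ 2; 0].
Proof.
move=> a0 b0 c0 abc; rewrite /coord_values /corner_coord /mid_coord.
rewrite (ger0_norm a0) (ger0_norm b0) (ger0_norm c0).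
do ![congr cons]; minmax.
Qed.

Lemma corner_coordC a b c : corner_coord a b c = corner_coord a c b.
Proof. by rewrite /corner_coord addrAC. Qed.

Lemma mid_coordC a b c : mid_coord a b c = mid_coord b a c.
Proof. by rewrite /mid_coord (minC a) (addrC a). Qed.

Lemma coord_values_perm a b c :
  let v i := nth 0 (coord_values a b c) i in
  coord_values b a c = [seq v i | i <- [:: 1; 0; 2; 3; 5; 4]%N] /\
  coord_values c a b = [seq v i | i <- [:: 2; 0; 1; 4; 5; 3]%N].
Proof.
rewrite /coord_values /= (mid_coordC b a) (mid_coordC c a) (mid_coordC c b).
by rewrite (corner_coordC c b) (corner_coordC a c) (corner_coordC b c).
Qed.

Lemma coord_values_corner1 a b c : 0 <= a -> 0 <= b -> 0 <= c -> a + c <= b ->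
  coord_values a b c = [:: 0; b - a - c; 0; a *+ 2; 0; c *+ 2].
Proof.
move=> a0 b0 c0 acb; have := coord_values_corner0 b0 a0 c0 acb.
by rewrite (coord_values_perm a b c).1 => -[]; rewrite /coord_values /= => -> -> -> -> -> ->.
Qed.

Lemma coord_values_corner2 a b c : 0 <= a -> 0 <= b -> 0 <= c -> a + b <= c ->
  coord_values a b c = [:: 0; 0; c - a - b; 0; a *+ 2; b *+ 2].
Proof.
move=> a0 b0 c0 abc; have := coord_values_corner0 c0 a0 b0 abc.
by rewrite (coord_values_perm a b c).2 => -[]; rewrite /coord_values /= => -> -> -> -> -> ->.
Qed.

Lemma coord_values_mid a b c : a <= b + c -> b <= a + c -> c <= a + b ->
  coord_values a b c = [:: 0; 0; 0; a + b - c; a + c - b; b + c - a].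
Proof.
move=> abc bac cab; have [a0 b0 c0] : [/\ 0 <= a, 0 <= b & 0 <= c] by split; lra.
rewrite /coord_values /corner_coord /mid_coord.
rewrite (ger0_norm a0) (ger0_norm b0) (ger0_norm c0).
do ![congr cons]; minmax.
Qed.

Lemma signed_coordE s t a b c x0 x1 x2 x3 x4 x5 :
  coord_values a b c = [:: x0; x1; x2; x3; x4; x5] ->
  signed_coord s t a b c = fun k : nat => nth 0
    [:: x0; x1; x2; if s then 0 else x3; if s then x3 else 0;
        if t then 0 else x4; if t then x4 else 0;
        if s (+) t then 0 else x5; if s (+) t then x5 else 0] k.
Proof. by rewrite /signed_coord => -[] -> -> -> -> -> ->. Qed.

(** The piece number [r] of the face with signs [s] and [t]: the three corners,
    then the middle triangle. *)
Definition signed_triangle s t (r : nat) : seq nat :=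
  let e01 := if s then 4%N else 3%N in let e02 := if t then 6%N else 5%N in
  let e12 := if s (+) t then 8%N else 7%N in
  nth [::] [:: [:: 0; e01; e02]; [:: 1; e01; e12]; [:: 2; e02; e12];
               [:: e01; e02; e12]]%N r.

Lemma projective_gridP (T : seq nat) :
  T \in projective_grid <->
  exists s t r, (r < 4)%N /\ T = signed_triangle s t r.
Proof.
split=> [|[s [t [r [r4 ->]]]]].
  have : all (fun T => has (fun s => has (fun t => has (fun r =>
    T == signed_triangle s t r) (iota 0 4)) [:: true; false]) [:: true; false])
    projective_grid by [].
  move=> /allP/[apply] /hasP[s _ /hasP[t _ /hasP[r]]].
  by rewrite mem_iota => r4 /eqP->; exists s, t, r.
by case: r s t r4 => [|[|[|[|//]]]] [] [].
Qed.

Lemma signed_coord_support s t a b c : 0 <= a -> 0 <= b -> 0 <= c ->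
  exists2 T, T \in projective_grid
    & forall k, signed_coord s t a b c k != 0 -> k \in T.
Proof.
move=> a0 b0 c0.
have grid r : (r < 4)%N -> signed_triangle s t r \in projective_grid.
  by move=> r4; apply/projective_gridP; exists s, t, r.
have [h|h|h|[h1 h2 h3]] := regimes a0 b0 c0.
- rewrite (signed_coordE s t (coord_values_corner0 a0 b0 c0 h)).
  exists (signed_triangle s t 0); first exact: grid.
  by case: s t {grid} => -[] -[|[|[|[|[|[|[|[|[|k]]]]]]]]] //=; rewrite ?nth_nil eqxx.
- rewrite (signed_coordE s t (coord_values_corner1 a0 b0 c0 h)).
  exists (signed_triangle s t 1); first exact: grid.
  by case: s t {grid} => -[] -[|[|[|[|[|[|[|[|[|k]]]]]]]]] //=; rewrite ?nth_nil eqxx.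
- rewrite (signed_coordE s t (coord_values_corner2 a0 b0 c0 h)).
  exists (signed_triangle s t 2); first exact: grid.
  by case: s t {grid} => -[] -[|[|[|[|[|[|[|[|[|k]]]]]]]]] //=; rewrite ?nth_nil eqxx.
- rewrite (signed_coordE s t (coord_values_mid h1 h2 h3)).
  exists (signed_triangle s t 3); first exact: grid.
  by case: s t {grid} => -[] -[|[|[|[|[|[|[|[|[|k]]]]]]]]] //=; rewrite ?nth_nil eqxx.
Qed.

Lemma sum9 (f : nat -> R) : \sum_(k < 9) f k =
  f 0%N + f 1%N + f 2%N + f 3%N + f 4%N + f 5%N + f 6%N + f 7%N + f 8%N.
Proof. by rewrite !big_ord_recr big_ord0 /= add0r. Qed.

(** The absolute values of the three coordinates of a vector are recovered from
    its coordinates on the subdivided octahedron. *)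
Definition decode (x : nat -> R) : seq R :=
  [:: x 0%N + (x 3%N + x 4%N + x 5%N + x 6%N) / 2;
      x 1%N + (x 3%N + x 4%N + x 7%N + x 8%N) / 2;
      x 2%N + (x 5%N + x 6%N + x 7%N + x 8%N) / 2].

Lemma decode_signed s t a b c : 0 <= a -> 0 <= b -> 0 <= c ->
  decode (signed_coord s t a b c) = [:: a; b; c].
Proof.
move=> a0 b0 c0; have [h|h|h|[h1 h2 h3]] := regimes a0 b0 c0.
- rewrite (signed_coordE s t (coord_values_corner0 a0 b0 c0 h)).
  by case: s t => -[]; rewrite /decode /=; do ![congr cons]; lra.
- rewrite (signed_coordE s t (coord_values_corner1 a0 b0 c0 h)).
  by case: s t => -[]; rewrite /decode /=; do ![congr cons]; lra.
- rewrite (signed_coordE s t (coord_values_corner2 a0 b0 c0 h)).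
  by case: s t => -[]; rewrite /decode /=; do ![congr cons]; lra.
- rewrite (signed_coordE s t (coord_values_mid h1 h2 h3)).
  by case: s t => -[]; rewrite /decode /=; do ![congr cons]; lra.
Qed.

Lemma sum_decode (x : nat -> R) : \sum_(k < 9) x k = \sum_(y <- decode x) y.
Proof. by rewrite sum9 !big_cons big_nil; lra. Qed.

Lemma oct_coord_signedP u : exists s t (e : bool),
  u = (-1) ^+ e *: signed_row s t `|u ord0 0| `|u ord0 1| `|u ord0 2| /\
  oct_coord u = signed_coord s t `|u ord0 0| `|u ord0 1| `|u ord0 2|.
Proof.
have [s [t [e uE]]] := signed_rowP u; exists s, t, e; split=> //.
rewrite {1}uE; case: e {uE}; last by rewrite scale1r oct_coord_signed.
by rewrite expr1 scaleN1r oct_coordN oct_coord_signed.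
Qed.

Lemma decode_oct u :
  decode (oct_coord u) = [:: `|u ord0 0|; `|u ord0 1|; `|u ord0 2|].
Proof.
by have [s [t [e [_ ->]]]] := oct_coord_signedP u; rewrite decode_signed.
Qed.

Lemma oct_coord_sum u : \sum_(k < 9) oct_coord u k = norm1 u.
Proof. by rewrite sum_decode decode_oct !big_cons big_nil addr0 addrA. Qed.

Lemma oct_coord_ge0 u k : 0 <= oct_coord u k.
Proof.
by case: k => [|[|[|[|[|[|[|[|[|k]]]]]]]]]; rewrite /oct_coord /= ?nth_nil// le_max lexx.
Qed.

(** The sign of y relative to x and z is visible in the coordinates at the
    midpoints of xy and yz unless both vanish; then changing it does not change
    the vector or only negates it. *)
Lemma mid_coord_eq0 a b c : 0 <= a -> 0 <= b -> 0 <= c ->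
  mid_coord a b c = 0 -> mid_coord b c a = 0 -> b = 0 \/ a = 0 /\ c = 0.
Proof.
move=> a0 b0 c0; have [h|h|h|[h1 h2 h3]] := regimes a0 b0 c0.
- have [_ _ _ -> _ ->] := coord_values_corner0 a0 b0 c0 h; left; lra.
- have [_ _ _ -> _ ->] := coord_values_corner1 a0 b0 c0 h; right; lra.
- have [_ _ _ -> _ ->] := coord_values_corner2 a0 b0 c0 h; left; lra.
- have [_ _ _ -> _ ->] := coord_values_mid h1 h2 h3; left; lra.
Qed.

(** Faces with different signs share only those points for which the
    differing sign does not matter up to a global sign. *)
Lemma signed_coord_inj s t s' t' a b c : 0 <= a -> 0 <= b -> 0 <= c ->
  signed_coord s t a b c = signed_coord s' t' a b c ->
  exists e : bool, signed_row s t a b c = (-1) ^+ e *: signed_row s' t' a b c.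
Proof.
move=> a0 b0 c0 E.
have := (congr1 (@^~ 3%N) E, congr1 (@^~ 4%N) E, congr1 (@^~ 5%N) E,
         congr1 (@^~ 6%N) E, congr1 (@^~ 7%N) E, congr1 (@^~ 8%N) E).
rewrite /signed_coord /= => -[[[[[E3 E4] E5] E6] E7] E8].
have sol (e : bool) : a = (-1) ^+ e * a -> (-1) ^+ s * b = (-1) ^+ e * ((-1) ^+ s' * b) ->
  (-1) ^+ t * c = (-1) ^+ e * ((-1) ^+ t' * c) ->
  exists e : bool, signed_row s t a b c = (-1) ^+ e *: signed_row s' t' a b c.
  by move=> ea eb ec; exists e; apply: row3P; rewrite !mxE.
have ab : s != s' -> t = t' -> b = 0 \/ a = 0 /\ c = 0.
  move=> ss tt; apply: mid_coord_eq0 => //; move: ss E3 E4 E7 E8; rewrite tt;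
  by case: (s) (s') (t') => -[] [].
have ac : s = s' -> t != t' -> c = 0 \/ a = 0 /\ b = 0.
  move=> ss tt; apply: mid_coord_eq0 => //; rewrite 1?(mid_coordC c b);
  move: tt E5 E6 E7 E8; rewrite ss; by case: (s') (t) (t') => -[] [].
have bc : s != s' -> t != t' -> a = 0 \/ b = 0 /\ c = 0.
  move=> ss tt; apply: mid_coord_eq0 => //; rewrite 1?(mid_coordC b a);
  by move: ss tt E3 E4 E5 E6; case: (s) (s') (t) (t') => -[] [] [].
have [ss|ss] := eqVneq s s'; have [tt|tt] := eqVneq t t'.
- by apply: (sol false); rewrite ?ss ?tt expr0 mul1r.
- have [c00|[a00 b00]] := ac ss tt.
    by apply: (sol false); rewrite ?ss ?c00 ?mulr0 ?expr0 ?mul1r.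
  apply: (sol true); rewrite ?a00 ?b00 ?mulr0//.
  by move: tt; case: (t) (t') => -[]; rewrite // ?expr0 ?expr1; lra.
- have [b00|[a00 c00]] := ab ss tt.
    by apply: (sol false); rewrite ?tt ?b00 ?mulr0 ?expr0 ?mul1r.
  apply: (sol true); rewrite ?a00 ?c00 ?mulr0//.
  by move: ss; case: (s) (s') => -[]; rewrite // ?expr0 ?expr1; lra.
- have [a00|[b00 c00]] := bc ss tt; last first.
    by apply: (sol false); rewrite ?b00 ?c00 ?mulr0 ?expr0 ?mul1r.
  apply: (sol true); rewrite ?a00 ?mulr0//.
    by move: ss; case: (s) (s') => -[]; rewrite // ?expr0 ?expr1; lra.
  by move: tt; case: (t) (t') => -[]; rewrite // ?expr0 ?expr1; lra.
Qed.

Lemma corner_coordZ (l : R) a b c : 0 <= l ->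
  corner_coord (l * a) (l * b) (l * c) = l * corner_coord a b c.
Proof.
move=> l0; rewrite /corner_coord !normrM (ger0_norm l0) -!mulrBr.
by rewrite -{1}(mulr0 l) maxr_pMr.
Qed.

Lemma edge_coordZ (l : R) a b c : 0 <= l ->
  edge_coord (l * a) (l * b) (l * c) = l * edge_coord a b c.
Proof.
move=> l0; rewrite /edge_coord -mulrDr -mulrBr !normrM (ger0_norm l0) -!mulrBr.
by rewrite -minr_pMr// -{1}(mulr0 l) -maxr_pMr.
Qed.

Lemma oct_coordZ (l : R) u k : 0 <= l ->
  oct_coord (l *: u) k = l * oct_coord u k.
Proof.
move=> l0; rewrite /oct_coord !mxE -!mulrN !corner_coordZ// !edge_coordZ//.
by case: k => [|[|[|[|[|[|[|[|[|k]]]]]]]]] //=; rewrite nth_nil mulr0.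
Qed.

Lemma norm1_gt0 u : u != 0 -> 0 < norm1 u.
Proof.
move=> u0; rewrite lt_neqAle !addr_ge0// andbT; apply: contraNneq u0 => /esym.
move/eqP; rewrite !paddr_eq0 ?addr_ge0// !normr_eq0 => /andP[/andP[/eqP? /eqP?] /eqP?].
by apply/eqP/row3P; rewrite mxE.
Qed.

Lemma oct_coord_polyhedron u : u != 0 ->
  polyhedron R 9 projective_grid (fun k => oct_coord u k / norm1 u).
Proof.
move=> /norm1_gt0 n0; split.
- by move=> k; rewrite divr_ge0 ?oct_coord_ge0// ltW.
- by rewrite -mulr_suml oct_coord_sum divff// gt_eqF.
have [s [t [e [_ ->]]]] := oct_coord_signedP u.
have [T Tg TP] := signed_coord_support s t (normr_ge0 (u ord0 0))
  (normr_ge0 (u ord0 1)) (normr_ge0 (u ord0 2)).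
exists T => // k; rewrite mulf_eq0 invr_eq0 (gt_eqF n0) orbF; exact: TP.
Qed.

Definition oct_sphere (u : sphere R 2) : polyhedron R 9 projective_grid :=
  SigSub (mem_set (oct_coord_polyhedron (sphere_neq0 (set_valP u)))).

Lemma oct_coord_inj u w : oct_coord u = oct_coord w ->
  exists e : bool, u = (-1) ^+ e *: w.
Proof.
move=> uw; have := decode_oct u; rewrite uw decode_oct => -[n0 n1 n2].
have [s [t [e [uE uc]]]] := oct_coord_signedP u.
have [s' [t' [e' [wE wc]]]] := oct_coord_signedP w.
rewrite uw {uw} wc n0 n1 n2 in uc; rewrite n0 n1 n2 in wE.
have [e'' E] := signed_coord_inj (normr_ge0 _) (normr_ge0 _) (normr_ge0 _) uc.
exists (e (+) (e'' (+) e')).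
rewrite uE wE E !scalerA -!signr_addb.
by case: (e) (e') (e'') => -[] [].
Qed.

(** After normalization two points of the sphere have equal images when they lie
    on a common line; the sphere meets this line in two antipodal points. *)
Lemma oct_sphere_antipodal (u w : sphere R 2) :
  (oct_sphere u == oct_sphere w) = antipodal_rel u w.
Proof.
have u1 := set_valP u; have w1 := set_valP w.
have u0 := sphere_neq0 u1; have w0 := sphere_neq0 w1.
apply/eqP/orP => [/(congr1 val) /= E|].
  have nu := norm1_gt0 u0; have nw := norm1_gt0 w0.
  pose l := norm1 (val u) / norm1 (val w).
  have l0 : 0 < l by rewrite divr_gt0.
  have : oct_coord (val u) = oct_coord (l *: val w).
    apply/funext => k; rewrite oct_coordZ ?ltW//.
    have [k9|k9] := ltnP k 9; last by rewrite /oct_coord !nth_default// mulr0.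
    have /= := congr1 (fun f : 'I_9 -> R => f (Ordinal k9)) E.
    by move/(canRL (divfK (lt0r_neq0 nu))) ->; rewrite /l; field; rewrite !gt_eqF.
  move=> /oct_coord_inj[e uE].
  have l1 : l = 1.
    apply: (sphere_ray_unique w1) (ltW l0).
    have -> : l *: val w = (-1) ^+ e *: val u by rewrite uE scalerA -signr_addb addbb scale1r.
    rewrite /sphere /=; under eq_bigr do rewrite mxE exprMn sqrr_sign mul1r.
    exact: u1.
  rewrite l1 scale1r in uE; rewrite uE.
  by case: e {uE}; rewrite ?expr0 ?expr1 ?scale1r ?scaleN1r; [right|left].
move=> uw; apply: val_inj; apply/funext => k /=.
by case: uw => /eqP -> //; rewrite oct_coordN /norm1 !mxE !normrN.
Qed.

Lemma continuous_oct_coord (k : nat) :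
  continuous (fun u : sphere R 2 => oct_coord (val u) k).
Proof.
have cst (r : R) : continuous (fun _ : sphere R 2 => r) by exact: cst_continuous.
have cu := @continuous_sphere_coord R 2.
have cc (f g h : sphere R 2 -> R) : continuous f -> continuous g -> continuous h ->
    continuous (fun p => corner_coord (f p) (g p) (h p)).
  move=> cf cg ch; apply: continuous_maxr (cst 0) _.
  apply: continuous_subr (continuous_normr ch).
  exact: continuous_subr (continuous_normr cf) (continuous_normr cg).
have ce (f g h : sphere R 2 -> R) : continuous f -> continuous g -> continuous h ->
    continuous (fun p => edge_coord (f p) (g p) (h p)).
  move=> cf cg ch; apply: continuous_maxr (cst 0) _.
  have cD := continuous_normr (continuous_addr cf cg).
  apply: continuous_minr; last exact: continuous_subr cD (continuous_normr ch).
  exact: continuous_subr cD (continuous_normr (continuous_subr cf cg)).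
rewrite /oct_coord.
case: k => [|[|[|[|[|[|[|[|[|k]]]]]]]]] /=; last by under eq_fun do rewrite nth_nil; exact: cst.
- exact: cc.
- exact: cc.
- exact: cc.
- exact: ce.
- by apply: ce => //; exact: continuous_oppr.
- exact: ce.
- by apply: ce => //; exact: continuous_oppr.
- exact: ce.
- by apply: ce => //; exact: continuous_oppr.
Qed.

Lemma continuous_oct_sphere : continuous oct_sphere.
Proof.
apply: continuous_polyhedron => k /=.
apply: continuous_divr.
- by move=> u; rewrite gt_eqF// norm1_gt0//; exact: sphere_neq0 (set_valP u).
- exact: continuous_oct_coord.
- have cu i := continuous_normr (@continuous_sphere_coord R 2 i).
  exact: continuous_addr (continuous_addr (cu 0) (cu 1)) (cu 2).
Qed.

(** In the face and piece supporting x, the vector is read off from x by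
    [decode], and the linear formulas of that piece give x back. *)
Lemma oct_coord_onto (x : nat -> R) : (forall k, 0 <= x k) ->
  (exists2 T, T \in projective_grid & forall k, x k != 0 -> k \in T) ->
  exists u, oct_coord u = x.
Proof.
move=> x0 [T /projective_gridP[s [t [r [r4 ->]]]] xT].
have out k : k \notin signed_triangle s t r -> x k = 0.
  by apply: contraNeq => /xT.
set p := x (if s then 4 else 3)%N; set q := x (if t then 6 else 5)%N.
set v := x (if s (+) t then 8 else 7)%N.
have xE : x = fun k : nat => nth 0
    [:: x 0%N; x 1%N; x 2%N; if s then 0 else p; if s then p else 0;
        if t then 0 else q; if t then q else 0;
        if s (+) t then 0 else v; if s (+) t then v else 0] k.
  apply/funext => k; rewrite {}/p {}/q {}/v; move: out k; clear -r4.
  case: s t => -[] out; case=> [|[|[|[|[|[|[|[|[|k]]]]]]]]];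
  first [reflexivity
        |by rewrite /= ?nth_nil; apply: out; case: r r4 => [|[|[|[|]]]]].
have [a0 b0 c0] : [/\ 0 <= x 0%N, 0 <= x 1%N & 0 <= x 2%N] by split; apply: x0.
have [p0 q0 v0] : [/\ 0 <= p, 0 <= q & 0 <= v] by split; apply: x0.
have values : coord_values (x 0%N + (p + q) / 2) (x 1%N + (p + v) / 2)
    (x 2%N + (q + v) / 2) = [:: x 0%N; x 1%N; x 2%N; p; q; v].
  have zero k : k \notin signed_triangle s t r -> x k = 0 := out k.
  case: r r4 {xT out} zero => [|[|[|[|//]]]] _ zero.
  - have [e1 e2 e3] : [/\ x 1%N = 0, x 2%N = 0 & v = 0].
      by split; apply: zero; case: (s) (t) => -[].
    by rewrite coord_values_corner0; [do ![congr cons]| | | |]; lra.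
  - have [e1 e2 e3] : [/\ x 0%N = 0, x 2%N = 0 & q = 0].
      by split; apply: zero; case: (s) (t) => -[].
    by rewrite coord_values_corner1; [do ![congr cons]| | | |]; lra.
  - have [e1 e2 e3] : [/\ x 0%N = 0, x 1%N = 0 & p = 0].
      by split; apply: zero; case: (s) (t) => -[].
    by rewrite coord_values_corner2; [do ![congr cons]| | | |]; lra.
  - have [e1 e2 e3] : [/\ x 0%N = 0, x 1%N = 0 & x 2%N = 0].
      by split; apply: zero; case: (s) (t) => -[].
    by rewrite coord_values_mid; [do ![congr cons]| | |]; lra.
exists (signed_row s t (x 0%N + (p + q) / 2) (x 1%N + (p + v) / 2)
                       (x 2%N + (q + v) / 2)).
rewrite oct_coord_signed; [|lra..].
by rewrite (signed_coordE s t values) -xE.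
Qed.

Lemma oct_sphere_onto x : exists p, oct_sphere p = x.
Proof.
have [x0 x1 [T Tg xT]] := set_valP x.
pose y (k : nat) := if insub k is Some i then val x i else 0.
have yE (i : 'I_9) : y i = val x i by rewrite /y valK.
have [||u uy] := @oct_coord_onto y.
- by move=> k; rewrite /y; case: insubP => // i _ _; exact: x0.
- exists T => // k; rewrite /y; case: insubP => [i _ <-|]; last by rewrite eqxx.
  exact: xT.
have n1 : norm1 u = 1.
  by rewrite -oct_coord_sum uy -x1; apply: eq_bigr => i _; exact: yE.
have u0 : u != 0.
  apply/eqP => u0; move/eqP: n1.
  by rewrite u0 /norm1 !mxE normr0 !addr0 eq_sym oner_eq0.
have [l l0 lu] := sphere_ray u0.
exists (SigSub (mem_set lu)); apply: val_inj; apply/funext => i /=.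
rewrite -oct_coord_sum oct_coordZ ?ltW//.
under eq_bigr do rewrite oct_coordZ ?ltW//.
by rewrite -mulr_sumr oct_coord_sum n1 mulr1 mulrAC divff ?gt_eqF// mul1r uy yE.
Qed.

Theorem projective_grid_homeomorphic :
  homeomorphic (projective_space R 2) (polyhedron R 9 projective_grid).
Proof.
pose pi (u : sphere R 2) : projective_space R 2 :=
  (\pi_{eq_quot (@antipodal_equiv R 2)} u)%qT.
have piP (u w : sphere R 2) : pi u = pi w <-> antipodal_rel u w.
  by split=> [/eqmodP|/eqmodP].
have reprE (p : projective_space R 2) : pi (repr p) = p by exact: reprK.
pose f (p : projective_space R 2) := oct_sphere (repr p).
apply: (@compact_hausdorff_homeomorphic _ _ f).
- exact: compact_projective_space.
- exact: polyhedron_hausdorff.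
- apply: repr_comp_continuous; first exact: continuous_oct_sphere.
  by move=> u w; rewrite oct_sphere_antipodal => /eqP/piP.
- move=> p q /= /eqP; rewrite oct_sphere_antipodal => /piP.
  by rewrite !reprE.
- move=> x; have [u <-] := oct_sphere_onto x; exists (pi u) => /=.
  by apply/eqP; rewrite oct_sphere_antipodal; apply/piP; exact: reprE.
Qed.

End Octahedron.

(** * Two pairs of triangulated surfaces *)

(** The order of the triangles in the following lists matters: triangles at equal
    positions of the two lists for a surface correspond to each other in the
    isomorphism of facet-ridge graphs. *)
Definition torus_a : seq (seq nat) :=
  [:: [:: 0; 1; 5]; [:: 0; 1; 6]; [:: 0; 2; 4]; [:: 0; 2; 8]; [:: 0; 4; 5];
      [:: 0; 6; 8]; [:: 1; 2; 5]; [:: 1; 2; 8]; [:: 1; 6; 7]; [:: 1; 7; 8];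
      [:: 2; 3; 4]; [:: 2; 3; 5]; [:: 3; 4; 6]; [:: 3; 5; 6]; [:: 4; 5; 8];
      [:: 4; 6; 7]; [:: 4; 7; 8]; [:: 5; 6; 8]]%N.

Definition torus_b : seq (seq nat) :=
  [:: [:: 0; 2; 8]; [:: 0; 2; 4]; [:: 4; 5; 8]; [:: 1; 4; 5]; [:: 0; 5; 8];
      [:: 0; 1; 4]; [:: 1; 2; 8]; [:: 1; 2; 5]; [:: 2; 3; 4]; [:: 2; 3; 5];
      [:: 4; 7; 8]; [:: 1; 7; 8]; [:: 4; 6; 7]; [:: 1; 6; 7]; [:: 0; 5; 6];
      [:: 3; 4; 6]; [:: 3; 5; 6]; [:: 0; 1; 6]]%N.

Definition projective_a : seq (seq nat) :=
  [:: [:: 0; 3; 7]; [:: 0; 3; 8]; [:: 0; 4; 5]; [:: 0; 4; 6]; [:: 0; 5; 7];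
      [:: 0; 6; 8]; [:: 1; 3; 7]; [:: 1; 3; 8]; [:: 1; 4; 7]; [:: 1; 4; 8];
      [:: 2; 6; 7]; [:: 2; 6; 8]; [:: 2; 7; 8]; [:: 4; 5; 8]; [:: 4; 6; 7];
      [:: 5; 7; 8]]%N.

Definition projective_b : seq (seq nat) :=
  [:: [:: 0; 3; 6]; [:: 0; 4; 6]; [:: 1; 3; 4]; [:: 3; 4; 7]; [:: 1; 3; 6];
      [:: 4; 6; 7]; [:: 0; 3; 5]; [:: 0; 4; 5]; [:: 3; 5; 8]; [:: 4; 5; 8];
      [:: 2; 7; 8]; [:: 2; 6; 7]; [:: 2; 6; 8]; [:: 1; 4; 8]; [:: 3; 7; 8];
      [:: 1; 6; 8]]%N.

Lemma counterexample (R : realType) (X : topologicalType)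
    (base s s' : seq (seq nat)) qs qs' :
  homeomorphic X (polyhedron R 9 base) ->
  flip_path 9 base qs s -> flip_path 9 base qs' s' ->
  spanning 9 s -> spanning 9 s' -> triangle_list 9 s -> triangle_list 9 s' ->
  same_adjacency s s' ->
  has_universal_vertex 9 s -> ~~ has_universal_vertex 9 s' ->
  exists (V W : finType)
      (K : simplicial_complex V) (L : simplicial_complex W),
    [/\ homeomorphic (realization R K) X,
        homeomorphic (realization R L) X,
        ~ complex_iso K L
      & graph_iso (facet_ridge_graph K) (facet_ridge_graph L)].
Proof.
move=> Xbase fs fs' sP s'P sT s'T adj us us'.
have realizes r q (rP : spanning 9 r) : flip_path 9 base q r ->
    homeomorphic (realization R (span_complex rP)) X.
  move=> fr; apply: homeomorphic_sym; apply: homeomorphic_trans Xbase _.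
  by rewrite /realization realization_span; exact: flip_path_homeomorphic fr.
exists 'I_9, 'I_9, (span_complex sP), (span_complex s'P); split.
- exact: realizes fs.
- exact: realizes fs'.
- by move=> iso; move: us'; rewrite (complex_iso_universal iso us).
- exact: same_adjacency_graph_iso.
Qed.

Theorem mainTheorem3 (R : realType) :
  (exists (V W : finType)
      (K : simplicial_complex V) (L : simplicial_complex W),
    [/\ homeomorphic (realization R K) (torus R),
        homeomorphic (realization R L) (torus R),
        ~ complex_iso K L
      & graph_iso (facet_ridge_graph K) (facet_ridge_graph L)])
  /\
  (exists (V W : finType)
      (K : simplicial_complex V) (L : simplicial_complex W),
    [/\ homeomorphic (realization R K) (projective_space R 2),
        homeomorphic (realization R L) (projective_space R 2),
        ~ complex_iso K L
      & graph_iso (facet_ridge_graph K) (facet_ridge_graph L)]).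
Proof.
split.
  by apply: (counterexample (torus_grid_homeomorphic R)
    (qs := [:: (0, 3, 4, 2); (3, 7, 4, 6); (2, 7, 8, 1); (6, 8, 5, 0)]%N)
    (qs' := [:: (0, 3, 4, 2); (3, 7, 4, 6); (2, 7, 8, 1); (1, 4, 5, 0)]%N)
    (s := torus_b) (s' := torus_a)); vm_compute.
by apply: (counterexample (projective_grid_homeomorphic R)
  (qs := [:: (2, 5, 7, 8); (3, 6, 8, 0); (3, 5, 7, 0)]%N)
  (qs' := [:: (2, 5, 7, 8); (3, 8, 6, 1); (1, 7, 4, 3); (5, 7, 8, 3)]%N)
  (s := projective_a) (s' := projective_b)); vm_compute.
Qed.
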